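(* Let $(\mathbb{R}^n,g)$ be a pseudo-Euclidean space, $n\ge3$, with coordinates $x=(x_1,\dots,x_n)$ and $g_{ij}=\delta_{ij}\varepsilon_i$. Consider smooth functions $f(\xi)$, $h(\xi)$ and $\varphi(\xi)$, where $\xi=\sum_{i=1}^n\alpha_ix_i$, $\alpha_i\in\mathbb{R}$, $\sum_{i=1}^n\varepsilon_i\alpha_i^2=\varepsilon_{i_0}$, implicitly given by integrating $$\frac{f'}{f}(\xi)=x(\xi),\qquad\frac{\varphi'}{\varphi}(\xi)=kx(\xi),\qquad\frac{h'}{h}(\xi)=x(\xi)z(\xi),$$ where the functions $x(\xi)$ and $z(\xi)$ are given by $$\begin{cases}v(z)z'-c(a-rz)e^{\int v(z)\,dz}=0,\qquad c>0,\\ x=c\,e^{\int v(z)\,dz},\end{cases}\qquad v(z)=\frac{r(a-rz)}{r(r-1)z^2-2r(k+a)z+a^2-b},$$ with $k>0$, $a=(n-2)k-m$, $b=m(2k+1)-(n-2)k^2$, $n,m\in\mathbb{N}$; the functions are defined in the space where $f(\xi)>0$, $h(\xi)>0$, $\varphi(\xi)\neq0$. Then $(\mathbb{R}^n\times_fF_1^m)\times_hF_2^r$ with metric $\widetilde g=(\overline g\oplus f^2g_{F_1})\oplus h^2g_{F_2}$ is a Ricci-flat Einstein semi-Riemannian manifold, where $F_1^m$ is a Ricci-flat Einstein manifold of dimension $m$ and $F_2^r$ is an Einstein manifold of dimension $r$.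
   Context: Here $\varepsilon_i=\pm1$, $\varepsilon_{i_0}\in\{1,-1\}$, $r\in\mathbb{N}$, $\overline g=\frac1{\varphi^2}g$, and $(F_1^m,g_{F_1})$, $(F_2^r,g_{F_2})$ are semi-Riemannian manifolds. Primes denote derivatives with respect to $\xi$; $\int v(z)\,dz$ denotes an antiderivative of $v$ evaluated at $z=z(\xi)$ (the function $x(\xi)$ is not to be confused with the coordinates $x=(x_1,\dots,x_n)$). The notation $(\mathbb{R}^n\times_fF_1^m)\times_hF_2^r$ means the product of the part of $\mathbb{R}^n$ on which the functions are considered with $F_1$ and $F_2$, carrying the metric $\widetilde g$, functions of $\xi$ being pulled back via the projection.
   Formalization: The constant solution z = a/r is excluded, since the metric is then not Ricci-flat, and F_2 is taken Einstein with one suitable constant determined by f, h, φ, since Ricci-flatness fails for any other constant (for r = 1 no nonempty F_2 has this nonzero constant). *)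

(* Defs.v *)
From HB Require Import structures.
From mathcomp Require Import all_boot all_order all_algebra.
From mathcomp Require Import all_classical all_reals all_analysis.
Set Implicit Arguments.
Unset Strict Implicit.
Unset Printing Implicit Defensive.
Import Order.TTheory GRing.Theory Num.Theory.
Import numFieldNormedType.Exports.
Local Open Scope classical_set_scope.
Local Open Scope ring_scope.

(* One real variable, on an open set I. *)
Definition smooth1_on (R : realType) (I : set R) (f : R -> R) : Prop :=
  forall (j : nat) (t : R), I t -> derivable (derive1n j f) t 1.

Definition partial (R : realType) (d : nat) (i : 'I_d) (f : 'rV[R]_d -> R)
    (u : 'rV[R]_d) : R :=
  'D_(delta_mx 0 i) f u.

Fixpoint class_C (R : realType) (d k : nat) (U : set 'rV[R]_d)
    (f : 'rV[R]_d -> R) : Prop :=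
  (forall u, U u -> {for u, continuous f}) /\
  match k with
  | 0%N => True
  | k'.+1 => forall i : 'I_d,
      (forall u, U u -> derivable f u (delta_mx 0 i)) /\
      class_C k' U (partial i f)
  end.

Definition smooth_on (R : realType) (d : nat) (U : set 'rV[R]_d)
    (f : 'rV[R]_d -> R) : Prop :=
  forall k, class_C k U f.

(* The raw data of a d-dimensional semi-Riemannian manifold: a topological
   space, an atlas (the values of [coord i] outside [dom i] are irrelevant), and
   for each chart the matrix at p of the metric tensor in the coordinate frame
   of that chart.  The axioms are in [semi_riemannian]. *)
Record srm (R : realType) (d : nat) := Srm {
  points : topologicalType;
  chart : Type;
  dom : chart -> set points;
  coord : chart -> points -> 'rV[R]_d;
  metric : chart -> points -> 'M[R]_d }.

(* F \o (coord i)^-1 on the image of the chart, 0 elsewhere; single-valued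
   because charts are injective. *)
Definition in_chart (R : realType) (d : nat) (M : srm R d) (i : chart M)
    (a b : nat) (F : points M -> 'M[R]_(a, b)) (u : 'rV[R]_d) : 'M[R]_(a, b) :=
  xget 0 [set F p | p in [set p | dom i p /\ coord i p = u]].

Definition transition (R : realType) (d : nat) (M : srm R d) (i j : chart M) :
    'rV[R]_d -> 'rV[R]_d :=
  in_chart i (coord j).

Definition jacobian_mx (R : realType) (d : nat) (tau : 'rV[R]_d -> 'rV[R]_d)
    (u : 'rV[R]_d) : 'M[R]_d :=
  \matrix_(k, l) partial k (fun w => tau w 0 l) u.

Definition smooth_manifold (R : realType) (d : nat) (M : srm R d) : Prop :=
  [/\ hausdorff_space (points M) /\ @second_countable (points M),
      forall p : points M, exists i : chart M, dom i p,
      forall i : chart M,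
        [/\ open (dom i),
            forall p, dom i p -> {for p, continuous (@coord _ _ M i)},
            forall p q, dom i p -> dom i q -> coord i p = coord i q -> p = q
          & forall O : set (points M), open O -> O `<=` dom i ->
              open (coord i @` O)]
    & forall (i j : chart M) (l : 'I_d),
        smooth_on (coord i @` (dom i `&` dom j))
          (fun u => transition i j u 0 l)].

(* P collects a pseudo-orthonormal basis for G, with nu timelike vectors. *)
Definition has_index (R : realType) (d : nat) (G : 'M[R]_d) (nu : nat) : Prop :=
  exists (P : 'M[R]_d) (s : 'rV[R]_d),
    [/\ P \in unitmx, P *m G *m P^T = diag_mx s,
        forall j, s 0 j = 1 \/ s 0 j = -1
      & #|[set j | s 0 j == -1]%SET| = nu].

Definition semi_riemannian (R : realType) (d : nat) (M : srm R d) : Prop :=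
  [/\ smooth_manifold M,
      forall (i : chart M) (k l : 'I_d),
        smooth_on (coord i @` dom i) (fun u => in_chart i (metric i) u k l),
      forall (i j : chart M) (p : points M), dom i p -> dom j p ->
        let J := jacobian_mx (transition i j) (coord i p) in
        metric i p = J *m metric j p *m J^T,
      forall (i : chart M) (p : points M), dom i p ->
        (metric i p)^T = metric i p /\ metric i p \in unitmx
    & exists nu : nat, forall (i : chart M) (p : points M), dom i p ->
        has_index (metric i p) nu].

(* christoffel G i j k is Gamma^k_ij of the metric G on coordinate space. *)
Definition christoffel (R : realType) (d : nat) (G : 'rV[R]_d -> 'M[R]_d)
    (i j k : 'I_d) (u : 'rV[R]_d) : R :=
  2^-1 * \sum_(l < d) invmx (G u) k l *
    (partial i (fun w => G w j l) u + partial j (fun w => G w i l) u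
     - partial l (fun w => G w i j) u).

(* Sign convention: round spheres have positive Ricci curvature. *)
Definition ricci_coord (R : realType) (d : nat) (G : 'rV[R]_d -> 'M[R]_d)
    (u : 'rV[R]_d) : 'M[R]_d :=
  \matrix_(i, j) \sum_(k < d)
    (partial k (christoffel G i j k) u - partial j (christoffel G i k k) u
     + \sum_(l < d) (christoffel G k l k u * christoffel G i j l u
                     - christoffel G j l k u * christoffel G i k l u)).

Definition ricci (R : realType) (d : nat) (M : srm R d) (i : chart M)
    (p : points M) : 'M[R]_d :=
  ricci_coord (in_chart i (metric i)) (coord i p).

Definition einstein (R : realType) (d : nat) (M : srm R d) (lambda : R) : Prop :=
  forall (i : chart M) (p : points M), dom i p ->
    ricci i p = lambda *: metric i p.

Definition ricci_flat (R : realType) (d : nat) (M : srm R d) : Prop :=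
  einstein M 0.

(* The metric g_ij = delta_ij eps_i on U, with one global chart. *)
Definition pseudo_euclidean (R : realType) (n : nat) (eps : 'rV[R]_n)
    (U : set 'rV[R]_n) : srm R n :=
  @Srm R n (set_type U : topologicalType) unit (fun=> setT) (fun=> set_val)
    (fun _ _ => diag_mx eps).

(* (M, g / phi^2) *)
Definition conformal (R : realType) (d : nat) (M : srm R d)
    (phi : points M -> R) : srm R d :=
  @Srm R d (points M) (chart M) (@dom _ _ M) (@coord _ _ M)
    (fun i p => (phi p ^+ 2)^-1 *: metric i p).

(* B x_f F, with metric g_B + f^2 g_F *)
Definition warped_product (R : realType) (d e : nat) (B : srm R d)
    (f : points B -> R) (F : srm R e) : srm R (d + e) :=
  @Srm R (d + e) (points B * points F)%type (chart B * chart F)%type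
    (fun i => dom i.1 `*` dom i.2)
    (fun i p => row_mx (coord i.1 p.1) (coord i.2 p.2))
    (fun i p => block_mx (metric i.1 p.1) 0 0 (f p.1 ^+ 2 *: metric i.2 p.2)).

Definition linear_form (R : realType) (n : nat) (alpha x : 'rV[R]_n) : R :=
  \sum_(i < n) alpha 0 i * x 0 i.

(* With xi = linear_form alpha: the sequential warped product
   (U x_f F1) x_h F2 over U = xi^-1(I), where U carries g / phi(xi)^2. *)
Definition seq_warped (R : realType) (n m r : nat) (eps alpha : 'rV[R]_n)
    (I : set R) (phi f h : R -> R) (F1 : srm R m) (F2 : srm R r) :
    srm R (n + m + r) :=
  let U := [set x | I (linear_form alpha x)] in
  let base := conformal (M := pseudo_euclidean eps U)
                (fun p => phi (linear_form alpha (set_val p))) in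
  warped_product
    (B := warped_product (B := base)
            (fun p => f (linear_form alpha (set_val p))) F1)
    (fun q => h (linear_form alpha (set_val q.1))) F2.

Definition coef_a (R : realType) (n m : nat) (k : R) : R :=
  (n%:R - 2) * k - m%:R.

Definition coef_b (R : realType) (n m : nat) (k : R) : R :=
  m%:R * (2 * k + 1) - (n%:R - 2) * k ^+ 2.

Definition v_den (R : realType) (n m r : nat) (k z : R) : R :=
  r%:R * (r%:R - 1) * z ^+ 2 - 2 * r%:R * (k + coef_a n m k) * z
  + coef_a n m k ^+ 2 - coef_b n m k.

Definition v_fun (R : realType) (n m r : nat) (k z : R) : R :=
  r%:R * (coef_a n m k - r%:R * z) / v_den n m r k z.

(* Main.v *)
(** Every function involved depends on xi alone, so the Ricci tensor of the
    sequential warped product is computed in a product chart by the warped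
    product formulas, applied first over the conformally flat base and then over
    its product with F1. With f' = x f, phi' = k x phi and h' = x z h, Ricci
    flatness amounts to x' = x^2 (a - r z), to r z' = x D(z) with D the
    denominator of v, and to the Einstein constant of F2 being
    eps_i0 phi^2 h^2 x^2 D(z) / r. The first equation comes from differentiating
    x = c e^V. The second follows from the given one by cancelling a - r z, hence
    a priori only where a <> r z; since it determines the sign of z' there, z can
    only cross the value a / r transversally, once, and the equation extends by
    continuity. Finally phi^2 h^2 x^2 D(z) is a first integral of the system. *)
Require Import Defs.
From HB Require Import structures.
From mathcomp Require Import all_boot all_order all_algebra.
From mathcomp Require Import all_classical all_reals all_analysis.
From mathcomp Require Import ring lra.
Set Implicit Arguments.
Unset Strict Implicit.
Unset Printing Implicit Defensive.
Import Order.TTheory GRing.Theory Num.Theory.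
Import numFieldNormedType.Exports.
Local Open Scope classical_set_scope.
Local Open Scope ring_scope.

(** * Smooth functions and their partial derivatives *)

(** The proportionality phi'/phi = k f'/f is what closes the system. With it the coefficient of g_ij
    and the F1 block both become x' = x^2 ((n - 2) k - m - r z), which is the origin of a.
    Substituting this into the coefficient of alpha_i alpha_j leaves x^2 D(z) - r x z' = 0, and a^2
    - b is the part of D free of z. Dividing one equation by the other shows that v is the
    derivative of log x with respect to z, whence x = c e^V. The obstacle is that the given equation
    says nothing about z' where a = r z, and z is only assumed derivable, so z' cannot be extended
    there by continuity of the derivative. It has to be recovered from difference quotients, after
    excluding that z stays equal to a / r on a stretch. *)

Section DirectionalDerivatives.
Variables (R : realType) (V W : normedModType R) (f : V -> R) (g : W -> R).
Variables (a v : V) (b w : W).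
Hypothesis fg : forall h : R, f (h *: v + a) = g (h *: w + b).

Let growth_rateE :
  (fun h => h^-1 *: ((f \o shift a) (h *: v) - f a)) =
  (fun h => h^-1 *: ((g \o shift b) (h *: w) - g b)).
Proof.
have := fg 0; rewrite !scale0r !add0r => fgab.
by apply/funext => h /=; rewrite fg fgab.
Qed.

(** A directional derivative only sees the function along one line. Functions on different spaces
    can therefore be compared directly, which replaces the chain rule for all the affine
    substitutions below. *)
Lemma eq_derive_line : 'D_v f a = 'D_w g b.
Proof. by rewrite /derive growth_rateE. Qed.

Lemma eq_derivable_line : derivable f a v = derivable g b w.
Proof. by rewrite /derivable growth_rateE. Qed.

End DirectionalDerivatives.

Section PartialDerivatives.
Variables (R : realType) (d : nat).
Implicit Types (U : set 'rV[R]_d) (f g : 'rV[R]_d -> R) (u : 'rV[R]_d).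
Implicit Types (i : 'I_d).

Lemma open_near_eq U f g u : open U -> U u -> (forall w, U w -> f w = g w) ->
  \near u, f u = g u.
Proof.
by move=> oU Uu fg; apply: filterS fg _; apply: open_nbhs_nbhs.
Qed.

Lemma eq_partial U i f g u : open U -> U u -> (forall w, U w -> f w = g w) ->
  partial i f u = partial i g u.
Proof. by move=> oU Uu fg; apply: near_eq_derive; exact: open_near_eq fg. Qed.

Lemma eq_continuous_on U f g : open U -> (forall w, U w -> f w = g w) ->
  (forall u, U u -> {for u, continuous f}) -> forall u, U u -> {for u, continuous g}.
Proof.
move=> oU fg cf u Uu; rewrite /prop_for /continuous_at -(fg _ Uu).
have fg_near := open_near_eq oU Uu fg.
exact: cvg_trans (near_eq_cvg fg_near) (cf u Uu).
Qed.

Lemma eq_class_C k U f g : open U -> (forall w, U w -> f w = g w) ->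
  class_C k U f -> class_C k U g.
Proof.
move=> oU; elim: k f g => [|k IH] f g fg /= [cf df]; split.
- exact: eq_continuous_on fg cf.
- by [].
- exact: eq_continuous_on fg cf.
move=> i; have [dfi Ci] := df i; split.
  move=> u Uu; apply: near_eq_derivable (dfi u Uu).
  exact: open_near_eq fg.
by apply: IH Ci => w Uw; exact: eq_partial fg.
Qed.

Lemma class_C_continuous k U f u : class_C k U f -> U u -> {for u, continuous f}.
Proof. by case: k => [|k] /= [cf _] Uu; exact: cf. Qed.

Lemma class_CW k U f : class_C k.+1 U f -> class_C k U f.
Proof.
elim: k f => [|k IH] f [cf df]; first by split.
by split=> // i; have [dfi Ci] := df i; split=> //; exact: IH.
Qed.

Lemma class_C_cst k U (a : R) : class_C k U (fun=> a).
Proof.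
elim: k a => [|k IH] a; (split; first by move=> u _; exact: cst_continuous).
  by [].
move=> i; split=> [u _|]; first exact: derivable_cst.
by rewrite (_ : partial i _ = fun=> 0) //; apply/funext => u; exact: derive_cst.
Qed.

Lemma class_CD k U f g : open U ->
  class_C k U f -> class_C k U g -> class_C k U (fun u => f u + g u).
Proof.
move=> oU; elim: k f g => [|k IH] f g Cf Cg; split.
- move=> u Uu.
  exact: cvgD (class_C_continuous Cf Uu) (class_C_continuous Cg Uu).
- by [].
- move=> u Uu.
  exact: cvgD (class_C_continuous Cf Uu) (class_C_continuous Cg Uu).
move=> i; have [[_ df] [_ dg]] := (Cf, Cg).
have [[dfi Cfi] [dgi Cgi]] := (df i, dg i); split=> [u Uu|].
  by apply: derivableD; [exact: dfi|exact: dgi].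
apply: eq_class_C (IH _ _ Cfi Cgi) => // w Uw.
by rewrite /partial deriveD //; [exact: dfi|exact: dgi].
Qed.

Lemma class_CM k U f g : open U ->
  class_C k U f -> class_C k U g -> class_C k U (fun u => f u * g u).
Proof.
move=> oU; elim: k f g => [|k IH] f g Cf Cg; split.
- move=> u Uu.
  exact: cvgM (class_C_continuous Cf Uu) (class_C_continuous Cg Uu).
- by [].
- move=> u Uu.
  exact: cvgM (class_C_continuous Cf Uu) (class_C_continuous Cg Uu).
move=> i; have [[_ df] [_ dg]] := (Cf, Cg).
have [[dfi Cfi] [dgi Cgi]] := (df i, dg i); split=> [u Uu|].
  by apply: derivableM; [exact: dfi|exact: dgi].
apply: (@eq_class_C _ _ (fun u => f u * partial i g u + g u * partial i f u)) => //.
  by move=> w Uw; rewrite /partial deriveM //; [exact: dfi|exact: dgi].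
by apply: class_CD => //; apply: IH => //; exact: class_CW.
Qed.

(** The partial derivatives of 1/f are products of 1/f with itself and with those of f, so the
    induction hypothesis for 1/f suffices. *)
Lemma class_CV k U f : open U -> (forall u, U u -> f u != 0) ->
  class_C k U f -> class_C k U (fun u => (f u)^-1).
Proof.
move=> oU f0; elim: k => [|k IH] Cf; split.
- by move=> u Uu; exact: cvgV (f0 u Uu) (class_C_continuous Cf Uu).
- by [].
- by move=> u Uu; exact: cvgV (f0 u Uu) (class_C_continuous Cf Uu).
move=> i; have [_ df] := Cf; have [dfi Cfi] := df i; split=> [u Uu|].
  by apply: derivableV; [exact: f0|exact: dfi].
apply: (@eq_class_C _ _
  (fun u => -1 * ((f u)^-1 * (f u)^-1 * partial i f u))) => //.
  move=> w Uw; rewrite /partial deriveV; [|exact: f0|exact: dfi].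
  by rewrite scaleNr mulN1r /GRing.scale /= -exprVn expr2.
have CV := IH (class_CW Cf).
by apply: class_CM => //; [exact: class_C_cst|apply: class_CM => //; exact: class_CM].
Qed.

Lemma eq_smooth_on U f g : open U -> (forall w, U w -> f w = g w) ->
  smooth_on U f -> smooth_on U g.
Proof. by move=> oU fg Sf k; exact: eq_class_C (Sf k). Qed.

Lemma smooth_on_cst U (a : R) : smooth_on U (fun=> a).
Proof. by move=> k; exact: class_C_cst. Qed.

Lemma smooth_onD U f g : open U ->
  smooth_on U f -> smooth_on U g -> smooth_on U (fun u => f u + g u).
Proof. by move=> oU Sf Sg k; exact: class_CD. Qed.

Lemma smooth_onM U f g : open U ->
  smooth_on U f -> smooth_on U g -> smooth_on U (fun u => f u * g u).
Proof. by move=> oU Sf Sg k; exact: class_CM. Qed.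

Lemma smooth_onN U f : open U -> smooth_on U f -> smooth_on U (fun u => - f u).
Proof.
move=> oU Sf; apply: (@eq_smooth_on _ (fun u => -1 * f u)) => //.
  by move=> w _; rewrite mulN1r.
by apply: smooth_onM => //; exact: smooth_on_cst.
Qed.

Lemma smooth_onV U f : open U -> (forall u, U u -> f u != 0) ->
  smooth_on U f -> smooth_on U (fun u => (f u)^-1).
Proof. by move=> oU f0 Sf k; exact: class_CV. Qed.

Lemma smooth_onX U f n : open U -> smooth_on U f -> smooth_on U (fun u => f u ^+ n).
Proof.
move=> oU Sf; elim: n => [|n IH]; first exact: smooth_on_cst.
apply: (@eq_smooth_on _ (fun u => f u * f u ^+ n)) => //.
  by move=> w _; rewrite exprS.
exact: smooth_onM.
Qed.

Lemma smooth_on_sum (J : Type) (s : seq J) (P : pred J) (F : J -> 'rV[R]_d -> R) U :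
  open U -> (forall j, smooth_on U (F j)) ->
  smooth_on U (fun u => \sum_(j <- s | P j) F j u).
Proof.
move=> oU SF; elim: s => [|j s IH].
  by apply: (@eq_smooth_on _ (fun=> 0)) => [//|w _|];
    [rewrite big_nil|exact: smooth_on_cst].
apply: (@eq_smooth_on _ (fun u => (if P j then F j u else 0) +
                          \sum_(j <- s | P j) F j u)) => //.
  by move=> w _; rewrite big_cons; case: (P j) => //; rewrite add0r.
by apply: smooth_onD => //; case: (P j) => //; exact: smooth_on_cst.
Qed.

Lemma smooth_on_prod (J : Type) (s : seq J) (P : pred J) (F : J -> 'rV[R]_d -> R) U :
  open U -> (forall j, smooth_on U (F j)) ->
  smooth_on U (fun u => \prod_(j <- s | P j) F j u).
Proof.
move=> oU SF; elim: s => [|j s IH].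
  by apply: (@eq_smooth_on _ (fun=> 1)) => [//|w _|];
    [rewrite big_nil|exact: smooth_on_cst].
apply: (@eq_smooth_on _ (fun u => (if P j then F j u else 1) *
                          \prod_(j <- s | P j) F j u)) => //.
  by move=> w _; rewrite big_cons; case: (P j) => //; rewrite mul1r.
by apply: smooth_onM => //; case: (P j) => //; exact: smooth_on_cst.
Qed.

Lemma smooth_on_partial U f i : smooth_on U f -> smooth_on U (partial i f).
Proof. by move=> Sf k; have [_ df] := Sf k.+1; have [] := df i. Qed.

Lemma smooth_on_derivable U f i u : smooth_on U f -> U u ->
  derivable f u (delta_mx 0 i).
Proof. by move=> Sf Uu; have [_ df] := Sf 1; have [+ _] := df i; exact. Qed.

Lemma smooth_on_continuous U f u : smooth_on U f -> U u -> {for u, continuous f}.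
Proof. by move=> Sf; exact: class_C_continuous (Sf 0%N). Qed.

Lemma partial_cst i (a : R) u : partial i (fun=> a) u = 0.
Proof. exact: derive_cst. Qed.

Lemma partialM U f g i u : smooth_on U f -> smooth_on U g -> U u ->
  partial i (fun w => f w * g w) u = f u * partial i g u + partial i f u * g u.
Proof.
move=> Sf Sg Uu; rewrite /partial deriveM; try exact: smooth_on_derivable Uu.
by rewrite /GRing.scale /= [X in _ + X]mulrC.
Qed.

Lemma partialN U f i u : smooth_on U f -> U u ->
  partial i (fun w => - f w) u = - partial i f u.
Proof. by move=> Sf Uu; apply: deriveN; exact: smooth_on_derivable Uu. Qed.

Lemma partialV U f i u : smooth_on U f -> U u -> f u != 0 ->
  partial i (fun w => (f w)^-1) u = - partial i f u / f u ^+ 2.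
Proof.
move=> Sf Uu f0; rewrite /partial deriveV //; last exact: smooth_on_derivable Uu.
by rewrite scaleNr /GRing.scale /= mulNr mulrC.
Qed.

Lemma partial_coord i (j : 'I_d) u : partial i (fun w => w 0 j) u = (j == i)%:R.
Proof.
rewrite /partial /derive.
rewrite (_ : (fun h => _) = fun h : R => h^-1 *: (h * (j == i)%:R)); last first.
  apply/funext => h /=; rewrite !mxE /= addrK; congr (_ *: (_ * _)).
(* The quotient is constant only for h nonzero; its value at h = 0 is 0, hence the punctured
   neighbourhood. *)
apply: cvg_lim => //; apply: cvg_near_cst.
near=> h; rewrite /GRing.scale /= mulKf //; near: h.
exact: nbhs_dnbhs_neq.
Unshelve. all: by end_near. Qed.

Lemma smooth_on_coord U (j : 'I_d) : smooth_on U (fun u => u 0 j).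
Proof.
case=> [|k]; (split; first by move=> u _; exact: coord_continuous) => // i; split.
  move=> u _; apply: diff_derivable; exact: differentiable_coord.
rewrite (_ : partial i _ = fun=> (j == i)%:R); first exact: class_C_cst.
by apply/funext => u; exact: partial_coord.
Qed.

End PartialDerivatives.

(** * Composition with linear forms and with the projections onto blocks *)

Section Composition.
Variable R : realType.

Lemma linear_form_line n (alpha u v : 'rV[R]_n) (h : R) :
  linear_form alpha (h *: v + u) = h * linear_form alpha v + linear_form alpha u.
Proof.
rewrite /linear_form mulr_sumr -big_split; apply: eq_bigr => i _.
by rewrite !mxE mulrDr mulrCA.
Qed.

Lemma linear_form_delta n (alpha : 'rV[R]_n) i :
  linear_form alpha (delta_mx 0 i) = alpha 0 i.
Proof.
rewrite /linear_form (bigD1 i) //= mxE !eqxx mulr1 big1 ?addr0 // => j ji.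
by rewrite mxE (negbTE ji) andbF mulr0.
Qed.

Lemma continuous_linear_form n (alpha : 'rV[R]_n) : continuous (linear_form alpha).
Proof.
move=> u; rewrite /continuous_at /linear_form.
by apply: (@smooth_on_continuous _ _ setT) => //; apply: smooth_on_sum;
  [exact: openT|move=> j; apply: smooth_onM; [exact: openT|exact: smooth_on_cst|
  exact: smooth_on_coord]].
Qed.

Lemma open_linear_form n (alpha : 'rV[R]_n) (I : set R) : open I ->
  open [set u | I (linear_form alpha u)].
Proof. by apply: open_comp => u _; exact: continuous_linear_form. Qed.

Lemma derive_linear_form n (alpha : 'rV[R]_n) (f : R -> R) i u :
  partial i (fun w => f (linear_form alpha w)) u
    = 'D_(alpha 0 i) f (linear_form alpha u).
Proof.
by apply: eq_derive_line => h; rewrite linear_form_line linear_form_delta.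
Qed.

Lemma partial_linear_form n (alpha : 'rV[R]_n) (f : R -> R) i u :
  derivable f (linear_form alpha u) 1 ->
  partial i (fun w => f (linear_form alpha w)) u
    = alpha 0 i * derive1 f (linear_form alpha u).
Proof.
move=> /[dup] df /derivable1_diffP Df.
rewrite derive_linear_form deriveE // deriv1E //.
Qed.

Lemma smooth1_on_derive1 (I : set R) (f : R -> R) :
  smooth1_on I f -> smooth1_on I (derive1 f).
Proof. by move=> Sf j t It; have := Sf j.+1 t It; rewrite derive1Sn. Qed.

Lemma smooth_on_linear_form n (alpha : 'rV[R]_n) (I : set R) (f : R -> R) :
  open I -> smooth1_on I f ->
  smooth_on [set u | I (linear_form alpha u)] (fun u => f (linear_form alpha u)).
Proof.
move=> oI Sf k; have oU := open_linear_form (alpha := alpha) oI.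
elim: k f Sf => [|k IH] f Sf.
  split=> // u Iu; apply: continuous_comp; first exact: continuous_linear_form.
  apply: differentiable_continuous; exact/derivable1_diffP/(Sf 0%N).
split=> [u Iu|i].
  apply: continuous_comp; first exact: continuous_linear_form.
  apply: differentiable_continuous; exact/derivable1_diffP/(Sf 0%N).
split=> [u Iu|].
  (* Derivability in the direction 1 is differentiability on the line, hence gives derivability in
     the direction alpha_i, which may be 0. *)
  have /derivable1_diffP/diff_derivable : derivable f (linear_form alpha u) 1.
    exact: (Sf 0%N).
  move=> /(_ (alpha 0 i)); rewrite -(eq_derivable_line (a := u)
    (v := delta_mx 0 i) (f := fun w => f (linear_form alpha w))) // => h.
  by rewrite linear_form_line linear_form_delta.
apply: (@eq_class_C _ _ _ _
  (fun u => alpha 0 i * derive1 f (linear_form alpha u))) => //.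
  by move=> w Iw; rewrite partial_linear_form //; exact: (Sf 0%N).
apply: class_CM => //; first exact: class_C_cst.
by apply: IH; exact: smooth1_on_derive1.
Qed.

Variables d e : nat.

Lemma lsubmx_line (u : 'rV[R]_(d + e)) i (h : R) :
  lsubmx (h *: delta_mx 0 (lshift e i) + u) = h *: delta_mx 0 i + lsubmx u.
Proof. by apply/rowP => j; rewrite !mxE eq_lshift. Qed.

Lemma rsubmx_line (u : 'rV[R]_(d + e)) i (h : R) :
  rsubmx (h *: delta_mx 0 (rshift d i) + u) = h *: delta_mx 0 i + rsubmx u.
Proof. by apply/rowP => j; rewrite !mxE eq_rshift. Qed.

Lemma lsubmx_rline (u : 'rV[R]_(d + e)) i (h : R) :
  lsubmx (h *: delta_mx 0 (rshift d i) + u) = lsubmx u.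
Proof. by apply/rowP => j; rewrite !mxE eq_lrshift andbF mulr0 add0r. Qed.

Lemma rsubmx_lline (u : 'rV[R]_(d + e)) i (h : R) :
  rsubmx (h *: delta_mx 0 (lshift e i) + u) = rsubmx u.
Proof. by apply/rowP => j; rewrite !mxE eq_rlshift andbF mulr0 add0r. Qed.

Lemma partial_lsubmx (f : 'rV[R]_d -> R) i (u : 'rV[R]_(d + e)) :
  partial (lshift e i) (fun w => f (lsubmx w)) u = partial i f (lsubmx u).
Proof.
by apply: eq_derive_line => h; rewrite lsubmx_line.
Qed.

Lemma partial_rsubmx (f : 'rV[R]_e -> R) i (u : 'rV[R]_(d + e)) :
  partial (rshift d i) (fun w => f (rsubmx w)) u = partial i f (rsubmx u).
Proof.
by apply: eq_derive_line => h; rewrite rsubmx_line.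
Qed.

Lemma partial_lsubmx0 (f : 'rV[R]_d -> R) i (u : 'rV[R]_(d + e)) :
  partial (rshift d i) (fun w => f (lsubmx w)) u = 0.
Proof.
rewrite -(derive_cst (f (lsubmx u)) u (delta_mx 0 (rshift d i))).
by apply: eq_derive_line => h; rewrite lsubmx_rline.
Qed.

Lemma partial_rsubmx0 (f : 'rV[R]_e -> R) i (u : 'rV[R]_(d + e)) :
  partial (lshift e i) (fun w => f (rsubmx w)) u = 0.
Proof.
rewrite -(derive_cst (f (rsubmx u)) u (delta_mx 0 (lshift e i))).
by apply: eq_derive_line => h; rewrite rsubmx_lline.
Qed.

Lemma continuous_lsubmx : continuous (lsubmx : 'rV[R]_(d + e) -> 'rV[R]_d).
Proof. by move=> u; apply: differentiable_continuous; exact: differentiable_lsubmx. Qed.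

Lemma continuous_rsubmx : continuous (rsubmx : 'rV[R]_(d + e) -> 'rV[R]_e).
Proof. by move=> u; apply: differentiable_continuous; exact: differentiable_rsubmx. Qed.

Lemma smooth_on_lsubmx (U : set 'rV[R]_d) (W : set 'rV[R]_(d + e))
  (f : 'rV[R]_d -> R) : (forall w, W w -> U (lsubmx w)) ->
  smooth_on U f -> smooth_on W (fun w => f (lsubmx w)).
Proof.
move=> WU Sf k; elim: k f Sf => [|k IH] f Sf.
  split=> // w /WU Uw; apply: continuous_comp; first exact: continuous_lsubmx.
  exact: smooth_on_continuous Uw.
split=> [w /WU Uw|i].
  apply: continuous_comp; first exact: continuous_lsubmx.
  exact: smooth_on_continuous Uw.
rewrite -(splitK i); case: (fintype.split i) => {}i /=; split.
- move=> w /WU Uw; have := smooth_on_derivable (i := i) Sf Uw.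
  by rewrite -(eq_derivable_line (f := fun w => f (lsubmx w)) (a := w)
    (v := delta_mx 0 (lshift e i))) // => h;
    rewrite lsubmx_line.
- rewrite (_ : partial _ _ = fun w => partial i f (lsubmx w)).
    exact/IH/smooth_on_partial.
  by apply/funext => w; rewrite partial_lsubmx.
- move=> w /WU Uw; have := @derivable_cst _ _ _ (f (lsubmx w)) w
    (delta_mx 0 (rshift d i)).
  rewrite -(eq_derivable_line (f := fun w => f (lsubmx w)) (a := w)
    (v := delta_mx 0 (rshift d i))) // => h.
  by rewrite lsubmx_rline.
rewrite (_ : partial _ _ = fun=> 0); first exact: class_C_cst.
by apply/funext => w; rewrite partial_lsubmx0.
Qed.

Lemma smooth_on_rsubmx (U : set 'rV[R]_e) (W : set 'rV[R]_(d + e))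
  (f : 'rV[R]_e -> R) : (forall w, W w -> U (rsubmx w)) ->
  smooth_on U f -> smooth_on W (fun w => f (rsubmx w)).
Proof.
move=> WU Sf k; elim: k f Sf => [|k IH] f Sf.
  split=> // w /WU Uw; apply: continuous_comp; first exact: continuous_rsubmx.
  exact: smooth_on_continuous Uw.
split=> [w /WU Uw|i].
  apply: continuous_comp; first exact: continuous_rsubmx.
  exact: smooth_on_continuous Uw.
rewrite -(splitK i); case: (fintype.split i) => {}i /=; split.
- move=> w /WU Uw; have := @derivable_cst _ _ _ (f (rsubmx w)) w
    (delta_mx 0 (lshift e i)).
  rewrite -(eq_derivable_line (f := fun w => f (rsubmx w)) (a := w)
    (v := delta_mx 0 (lshift e i))) // => h.
  by rewrite rsubmx_lline.
- rewrite (_ : partial _ _ = fun=> 0); first exact: class_C_cst.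
  by apply/funext => w; rewrite partial_rsubmx0.
- move=> w /WU Uw; have := smooth_on_derivable (i := i) Sf Uw.
  by rewrite -(eq_derivable_line (f := fun w => f (rsubmx w)) (a := w)
    (v := delta_mx 0 (rshift d i))) // => h;
    rewrite rsubmx_line.
rewrite (_ : partial _ _ = fun w => partial i f (rsubmx w)).
  exact/IH/smooth_on_partial.
by apply/funext => w; rewrite partial_rsubmx.
Qed.

End Composition.

(** * Ricci curvature of a warped metric in coordinates *)

Lemma sum_ord_cst (R : realType) (e : nat) (x : R) : \sum_(c < e) x = e%:R * x.
Proof. by rewrite sumr_const card_ord mulr_natl. Qed.

(** * Smoothness of determinants, inverses and Christoffel symbols *)

Section SmoothMatrices.
Variables (R : realType) (d : nat) (U : set 'rV[R]_d).
Hypothesis oU : open U.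

Lemma smooth_on_det n (A : 'rV[R]_d -> 'M[R]_n) :
  (forall i j, smooth_on U (fun u => A u i j)) -> smooth_on U (fun u => \det (A u)).
Proof.
move=> SA; rewrite /determinant; apply: smooth_on_sum => // s.
apply: smooth_onM => //; first exact: smooth_on_cst.
by apply: smooth_on_prod => // i; exact: SA.
Qed.

(** Cramer's rule: the entries of the inverse are cofactors divided by a determinant that does not
    vanish on U. *)
Lemma smooth_on_invmx n (A : 'rV[R]_d -> 'M[R]_n) :
  (forall i j, smooth_on U (fun u => A u i j)) ->
  (forall u, U u -> A u \in unitmx) ->
  forall i j, smooth_on U (fun u => invmx (A u) i j).
Proof.
move=> SA uA i j; apply: (@eq_smooth_on _ _ _
  (fun u => (\det (A u))^-1 *
    ((-1) ^+ (j + i) * \det (row' j (col' i (A u)))))) => //.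
  by move=> u Uu; rewrite /invmx uA // !mxE.
apply: smooth_onM => //.
  apply: smooth_onV => //; last exact: smooth_on_det.
  by move=> u /uA; rewrite unitmxE unitfE.
apply: smooth_onM => //; first exact: smooth_on_cst.
apply: smooth_on_det => a b.
by apply: (@eq_smooth_on _ _ _ (fun u => A u (lift j a) (lift i b))) => // u _;
  rewrite !mxE.
Qed.

Lemma smooth_on_christoffel (G : 'rV[R]_d -> 'M[R]_d) :
  (forall i j, smooth_on U (fun u => G u i j)) ->
  (forall u, U u -> G u \in unitmx) ->
  forall i j k, smooth_on U (christoffel G i j k).
Proof.
move=> SG uG i j k; rewrite /christoffel.
apply: smooth_onM => //; first exact: smooth_on_cst.
apply: smooth_on_sum => // l; apply: smooth_onM => //; first exact: smooth_on_invmx.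
apply: smooth_onD => //; first by apply: smooth_onD => //; exact: smooth_on_partial.
by apply: smooth_onN => //; exact: smooth_on_partial.
Qed.

Lemma christoffelC (G : 'rV[R]_d -> 'M[R]_d) :
  (forall u, U u -> (G u)^T = G u) ->
  forall i j k u, U u -> christoffel G i j k u = christoffel G j i k u.
Proof.
move=> sG i j k u Uu; congr (_ * _); apply: eq_bigr => l _; congr (_ * (_ - _)).
  by rewrite addrC.
by apply: eq_partial Uu _ => // w Uw; rewrite -{1}(sG w) // mxE.
Qed.

End SmoothMatrices.

Section Operators.
Variables (R : realType) (d : nat) (G : 'rV[R]_d -> 'M[R]_d) (f : 'rV[R]_d -> R).

Definition gradient (k : 'I_d) (u : 'rV[R]_d) : R :=
  \sum_l invmx (G u) k l * partial l f u.

Definition hessian (i j : 'I_d) (u : 'rV[R]_d) : R :=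
  partial j (partial i f) u - \sum_l christoffel G i j l u * partial l f u.

(** The divergence of the gradient, rather than the trace of the Hessian: this is the form that the
    Ricci contraction produces in [ricci_warped_rr]. *)
Definition laplacian (u : 'rV[R]_d) : R :=
  \sum_k (partial k (gradient k) u + \sum_l christoffel G k l k u * gradient l u).

End Operators.

Definition gradient_dot (R : realType) (d : nat) (G : 'rV[R]_d -> 'M[R]_d)
    (f g : 'rV[R]_d -> R) (u : 'rV[R]_d) : R :=
  \sum_k gradient G f k u * partial k g u.

Lemma smooth_on_gradient (R : realType) (d : nat) (U : set 'rV[R]_d)
  (G : 'rV[R]_d -> 'M[R]_d) (f : 'rV[R]_d -> R) : open U ->
  (forall i j, smooth_on U (fun u => G u i j)) ->
  (forall u, U u -> G u \in unitmx) -> smooth_on U f ->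
  forall k, smooth_on U (gradient G f k).
Proof.
move=> oU SG uG Sf k; apply: smooth_on_sum => // l.
by apply: smooth_onM => //; [exact: (smooth_on_invmx oU)|exact: smooth_on_partial].
Qed.

Section WarpedMetric.
Variables (R : realType) (d e : nat).
Variables (U : set 'rV[R]_d) (V : set 'rV[R]_e).
Variables (GB : 'rV[R]_d -> 'M[R]_d) (GF : 'rV[R]_e -> 'M[R]_e).
Variables (w : 'rV[R]_d -> R) (G : 'rV[R]_(d + e) -> 'M[R]_(d + e)).
Hypotheses (oU : open U) (oV : open V).
Hypothesis SB : forall i j, smooth_on U (fun u => GB u i j).
Hypothesis SF : forall i j, smooth_on V (fun u => GF u i j).
Hypothesis uB : forall u, U u -> GB u \in unitmx.
Hypothesis uF : forall u, V u -> GF u \in unitmx.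
Hypothesis sF : forall u, V u -> (GF u)^T = GF u.
Hypothesis Sw : smooth_on U w.
Hypothesis w0 : forall u, U u -> w u != 0.

Let UV : set 'rV[R]_(d + e) := [set u | U (lsubmx u) /\ V (rsubmx u)].

Hypothesis GE : forall u, UV u -> G u =
  block_mx (GB (lsubmx u)) 0 0 (w (lsubmx u) ^+ 2 *: GF (rsubmx u)).

Local Notation l_ := (lshift e).
Local Notation r_ := (rshift d).
Local Notation Gam := (christoffel G).

Lemma open_lrsubmx : open UV.
Proof.
apply: openI; apply: open_comp => // u _; first exact: continuous_lsubmx.
exact: continuous_rsubmx.
Qed.
Let oUV := open_lrsubmx.

Let UVl u : UV u -> U (lsubmx u). Proof. by case. Qed.
Let UVr u : UV u -> V (rsubmx u). Proof. by case. Qed.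

Lemma eq_partial_l f i g u : UV u -> (forall u, UV u -> f u = g (lsubmx u)) ->
  partial (l_ i) f u = partial i g (lsubmx u).
Proof. by move=> uv fg; rewrite (eq_partial _ oUV uv fg) partial_lsubmx. Qed.

Lemma eq_partial_l0 f c g u : UV u -> (forall u, UV u -> f u = g (lsubmx u)) ->
  partial (r_ c) f u = 0.
Proof. by move=> uv fg; rewrite (eq_partial _ oUV uv fg) partial_lsubmx0. Qed.

Lemma eq_partial_r f c g u : UV u -> (forall u, UV u -> f u = g (rsubmx u)) ->
  partial (r_ c) f u = partial c g (rsubmx u).
Proof. by move=> uv fg; rewrite (eq_partial _ oUV uv fg) partial_rsubmx. Qed.

Lemma eq_partial_r0 f i g u : UV u -> (forall u, UV u -> f u = g (rsubmx u)) ->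
  partial (l_ i) f u = 0.
Proof. by move=> uv fg; rewrite (eq_partial _ oUV uv fg) partial_rsubmx0. Qed.

Lemma eq_partial_cst f K a u : UV u -> (forall u, UV u -> f u = a) ->
  partial K f u = 0.
Proof. by move=> uv fg; rewrite (eq_partial _ oUV uv fg) partial_cst. Qed.

Lemma eq_partial_lr f i g h u : smooth_on U g -> smooth_on V h -> UV u ->
  (forall u, UV u -> f u = g (lsubmx u) * h (rsubmx u)) ->
  partial (l_ i) f u = partial i g (lsubmx u) * h (rsubmx u).
Proof.
move=> Sg Sh uv fg; rewrite (eq_partial _ oUV uv fg).
rewrite (partialM (U := UV)) //; last 2 first.
- exact: smooth_on_lsubmx Sg.
- exact: smooth_on_rsubmx Sh.
by rewrite partial_rsubmx0 mulr0 add0r partial_lsubmx.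
Qed.

Lemma eq_partial_rl f c g h u : smooth_on U g -> smooth_on V h -> UV u ->
  (forall u, UV u -> f u = g (lsubmx u) * h (rsubmx u)) ->
  partial (r_ c) f u = g (lsubmx u) * partial c h (rsubmx u).
Proof.
move=> Sg Sh uv fg; rewrite (eq_partial _ oUV uv fg).
rewrite (partialM (U := UV)) //; last 2 first.
- exact: smooth_on_lsubmx Sg.
- exact: smooth_on_rsubmx Sh.
by rewrite partial_lsubmx0 mul0r addr0 partial_rsubmx.
Qed.

Let Gll u i j : UV u -> G u (l_ i) (l_ j) = GB (lsubmx u) i j.
Proof. by move=> uv; rewrite GE // block_mxEul. Qed.
Let Glr u i c : UV u -> G u (l_ i) (r_ c) = 0.
Proof. by move=> uv; rewrite GE // block_mxEur mxE. Qed.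
Let Grl u i c : UV u -> G u (r_ c) (l_ i) = 0.
Proof. by move=> uv; rewrite GE // block_mxEdl mxE. Qed.
Let Grr u a b : UV u -> G u (r_ a) (r_ b) = w (lsubmx u) ^+ 2 * GF (rsubmx u) a b.
Proof. by move=> uv; rewrite GE // block_mxEdr mxE. Qed.

Let uRR u : UV u -> w (lsubmx u) ^+ 2 *: GF (rsubmx u) \in unitmx.
Proof.
by move=> [Uu Vu]; rewrite unitmxZ ?uF // unitfE expf_neq0 // w0.
Qed.

Lemma unitmx_warped u : UV u -> G u \in unitmx.
Proof.
by move=> uv; rewrite GE // block_diag_mx_unit uRR // uB //; exact: UVl.
Qed.

Let invG u : UV u -> invmx (G u) =
  block_mx (invmx (GB (lsubmx u))) 0 0
           (w (lsubmx u) ^- 2 *: invmx (GF (rsubmx u))).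
Proof.
move=> uv; have [Uu Vu] := uv.
rewrite GE // invmx_block_diag; last by rewrite block_diag_mx_unit uRR // uB.
by rewrite invmxZ ?uRR.
Qed.

Let iGll u i j : UV u -> invmx (G u) (l_ i) (l_ j) = invmx (GB (lsubmx u)) i j.
Proof. by move=> uv; rewrite invG // block_mxEul. Qed.
Let iGlr u i c : UV u -> invmx (G u) (l_ i) (r_ c) = 0.
Proof. by move=> uv; rewrite invG // block_mxEur mxE. Qed.
Let iGrl u i c : UV u -> invmx (G u) (r_ c) (l_ i) = 0.
Proof. by move=> uv; rewrite invG // block_mxEdl mxE. Qed.
Let iGrr u a b : UV u -> invmx (G u) (r_ a) (r_ b) =
  w (lsubmx u) ^- 2 * invmx (GF (rsubmx u)) a b.
Proof. by move=> uv; rewrite invG // block_mxEdr mxE. Qed.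

Let Sw2 : smooth_on U (fun u => w u ^+ 2). Proof. exact: smooth_onX. Qed.

Let dw2 i u : U u -> partial i (fun u => w u ^+ 2) u = 2 * w u * partial i w u.
Proof.
move=> Uu; rewrite (_ : (fun u => _) = fun u => w u * w u); last first.
  by apply/funext => v; rewrite expr2.
by rewrite (partialM (U := U)) //; ring.
Qed.

Lemma smooth_on_warped i j : smooth_on UV (fun u => G u i j).
Proof.
rewrite -(splitK i) -(splitK j).
case: (fintype.split i) => {}i; case: (fintype.split j) => {}j /=.
- apply: (@eq_smooth_on _ _ _ (fun u => GB (lsubmx u) i j)) => //.
    by move=> u uv; rewrite Gll.
  exact: smooth_on_lsubmx (SB i j).
- apply: (@eq_smooth_on _ _ _ (fun=> 0)) => //; last exact: smooth_on_cst.
  by move=> u uv; rewrite Glr.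
- apply: (@eq_smooth_on _ _ _ (fun=> 0)) => //; last exact: smooth_on_cst.
  by move=> u uv; rewrite Grl.
apply: (@eq_smooth_on _ _ _ (fun u => w (lsubmx u) ^+ 2 * GF (rsubmx u) i j)) => //.
  by move=> u uv; rewrite Grr.
apply: smooth_onM => //; first exact: smooth_on_lsubmx Sw2.
exact: smooth_on_rsubmx (SF i j).
Qed.

Let dGll K i j u : UV u -> partial K (fun v => G v (l_ i) (l_ j)) u =
  match fintype.split K with
  | inl k => partial k (fun v => GB v i j) (lsubmx u) | inr _ => 0 end.
Proof.
move=> uv; rewrite -{1}(splitK K); case: (fintype.split K) => k /=.
  by apply: (eq_partial_l _ _ (g := fun v => GB v i j)) => // v; exact: Gll.
by apply: (eq_partial_l0 _ (g := fun v => GB v i j)) => // v; exact: Gll.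
Qed.

Let dGlr K i c u : UV u -> partial K (fun v => G v (l_ i) (r_ c)) u = 0.
Proof. by move=> uv; apply: (@eq_partial_cst _ _ 0) => // v; exact: Glr. Qed.

Let dGrl K i c u : UV u -> partial K (fun v => G v (r_ c) (l_ i)) u = 0.
Proof. by move=> uv; apply: (@eq_partial_cst _ _ 0) => // v; exact: Grl. Qed.

Let dGrr K a b u : UV u -> partial K (fun v => G v (r_ a) (r_ b)) u =
  match fintype.split K with
  | inl k => 2 * w (lsubmx u) * partial k w (lsubmx u) * GF (rsubmx u) a b
  | inr c => w (lsubmx u) ^+ 2 * partial c (fun v => GF v a b) (rsubmx u) end.
Proof.
move=> uv; rewrite -{1}(splitK K); case: (fintype.split K) => k /=.
  rewrite (@eq_partial_lr _ _ (fun v => w v ^+ 2) (fun v => GF v a b)) //.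
    by rewrite dw2 //; exact: UVl.
  by move=> v; exact: Grr.
rewrite (@eq_partial_rl _ _ (fun v => w v ^+ 2) (fun v => GF v a b)) //.
by move=> v; exact: Grr.
Qed.

Let splitl (i : 'I_d) : fintype.split (l_ i) = inl i.
Proof. exact: (unsplitK (inl i)). Qed.
Let splitr (c : 'I_e) : fintype.split (r_ c) = inr c.
Proof. exact: (unsplitK (inr c)). Qed.
Let splitE := (splitl, splitr).

(** * Christoffel symbols and Ricci tensor of the warped metric, by blocks *)

Lemma christoffel_lll i j k u : UV u ->
  Gam (l_ i) (l_ j) (l_ k) u = christoffel GB i j k (lsubmx u).
Proof.
move=> uv; rewrite /christoffel big_split_ord /= [X in _ + X]big1 ?addr0.
  by congr (_ * _); apply: eq_bigr => l _; rewrite iGll // !dGll // !splitE.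
by move=> c _; rewrite iGlr // mul0r.
Qed.

Lemma christoffel_llr i j c u : UV u -> Gam (l_ i) (l_ j) (r_ c) u = 0.
Proof.
move=> uv; rewrite /christoffel big_split_ord /= !big1 ?addr0 ?mulr0 // => l _.
  by rewrite !dGlr // !dGll // !splitE !subr0 addr0 mulr0.
by rewrite iGrl // mul0r.
Qed.

Lemma christoffel_lrl i a k u : UV u -> Gam (l_ i) (r_ a) (l_ k) u = 0.
Proof.
move=> uv; rewrite /christoffel big_split_ord /= !big1 ?addr0 ?mulr0 // => l _.
  by rewrite iGlr // mul0r.
by rewrite dGrl // dGll // dGlr // !splitE !subr0 addr0 mulr0.
Qed.

Lemma christoffel_rll i a k u : UV u -> Gam (r_ a) (l_ i) (l_ k) u = 0.
Proof.
move=> uv; rewrite /christoffel big_split_ord /= !big1 ?addr0 ?mulr0 // => l _.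
  by rewrite iGlr // mul0r.
by rewrite dGll // !dGrl // !splitE !subr0 addr0 mulr0.
Qed.

Let sum_invGF u a c x : V u ->
  \sum_b invmx (GF u) c b * (x * GF u a b) = (c == a)%:R * x.
Proof.
move=> Vu; have := mulVmx (uF Vu) => /matrixP/(_ c a); rewrite !mxE => <-.
rewrite mulr_suml; apply: eq_bigr => b _.
have -> : GF u a b = GF u b a by rewrite -{1}(sF Vu) mxE.
by rewrite mulrCA mulrC.
Qed.

Lemma christoffel_lrr i a c u : UV u -> Gam (l_ i) (r_ a) (r_ c) u =
  (c == a)%:R * (partial i w (lsubmx u) / w (lsubmx u)).
Proof.
move=> uv; have [Uu Vu] := uv; have w0u := w0 Uu.
rewrite /christoffel big_split_ord /= big1 ?add0r; last first.
  by move=> l _; rewrite iGrl // mul0r.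
transitivity (2^-1 * \sum_b invmx (GF (rsubmx u)) c b *
   ((w (lsubmx u) ^- 2 * (2 * w (lsubmx u) * partial i w (lsubmx u))) *
    GF (rsubmx u) a b)).
  congr (_ * _); apply: eq_bigr => b _.
  rewrite iGrr // dGrr // dGlr // dGlr // !splitE; ring.
by rewrite sum_invGF //; field.
Qed.

Lemma christoffel_rlr i a c u : UV u -> Gam (r_ a) (l_ i) (r_ c) u =
  (c == a)%:R * (partial i w (lsubmx u) / w (lsubmx u)).
Proof.
move=> uv; rewrite -christoffel_lrr //; congr (_ * _); apply: eq_bigr => L _.
rewrite -(splitK L); case: (fintype.split L) => l /=; last first.
  by rewrite dGlr // dGrl // dGlr // !addr0 add0r.
by rewrite (iGrl _ _ uv) !mul0r.
Qed.

Lemma christoffel_rrl a b k u : UV u -> Gam (r_ a) (r_ b) (l_ k) u =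
  - (w (lsubmx u) * gradient GB w k (lsubmx u)) * GF (rsubmx u) a b.
Proof.
move=> uv; rewrite /christoffel big_split_ord /= [X in _ + X]big1 ?addr0; last first.
  by move=> c _; rewrite iGlr // mul0r.
rewrite /gradient [in RHS]mulr_sumr -sumrN mulr_suml mulr_sumr.
apply: eq_bigr => l _.
rewrite iGll // !dGrl // dGrr // !splitE.
by field.
Qed.

Lemma christoffel_rrr a b c u : UV u ->
  Gam (r_ a) (r_ b) (r_ c) u = christoffel GF a b c (rsubmx u).
Proof.
move=> uv; have [Uu Vu] := uv; have w0u := w0 Uu.
rewrite /christoffel big_split_ord /= big1 ?add0r; last first.
  by move=> l _; rewrite iGrl // mul0r.
congr (_ * _); apply: eq_bigr => l _; rewrite iGrr // !dGrr // !splitE.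
by field.
Qed.

Let SGB i j k : smooth_on U (christoffel GB i j k).
Proof. exact: smooth_on_christoffel. Qed.

Let SGF i j k : smooth_on V (christoffel GF i j k).
Proof. exact: smooth_on_christoffel. Qed.

Let Sgw k : smooth_on U (gradient GB w k).
Proof. exact: (smooth_on_gradient oU). Qed.

Let Sdw i : smooth_on U (fun u => partial i w u / w u).
Proof.
apply: smooth_onM => //; first exact: smooth_on_partial.
exact: smooth_onV.
Qed.

Let ddw i j u : U u -> partial j (fun u => partial i w u / w u) u =
  partial j (partial i w) u / w u - partial i w u * partial j w u / w u ^+ 2.
Proof.
move=> Uu; have w0u := w0 Uu.
rewrite (partialM (U := U)) //; last 2 first.
- exact: smooth_on_partial.
- exact: smooth_onV.
by rewrite (partialV (U := U)) //; field.
Qed.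

(** The base indices reproduce the Ricci tensor of the base, because Gamma^c_ij vanishes for a fibre
    index c. Each of the e fibre indices adds the same term - Hess w / w. *)
Lemma ricci_warped_ll i j u : UV u ->
  ricci_coord G u (l_ i) (l_ j) = ricci_coord GB (lsubmx u) i j
    - e%:R / w (lsubmx u) * hessian GB w i j (lsubmx u).
Proof.
move=> uv; have [Uu Vu] := uv; have w0u := w0 Uu.
rewrite !mxE big_split_ord /=; congr (_ + _).
  apply: eq_bigr => k _; rewrite big_split_ord /= [X in _ + (_ + X)]big1 ?addr0.
    congr (_ - _ + _).
    - by apply: eq_partial_l => // v; exact: christoffel_lll.
    - by apply: eq_partial_l => // v; exact: christoffel_lll.
    by apply: eq_bigr => l _; rewrite !christoffel_lll.
  by move=> c _; rewrite !christoffel_llr // mulr0 christoffel_lrl // mul0r subr0.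
transitivity (\sum_(c < e)
    - (hessian GB w i j (lsubmx u) / w (lsubmx u))); last first.
  by rewrite sum_ord_cst; field.
apply: eq_bigr => c _.
rewrite (@eq_partial_cst _ _ 0) //; last by move=> v; exact: christoffel_llr.
rewrite (eq_partial_l _ _ (g := fun v => partial i w v / w v)) //; last first.
  by move=> v uv'; rewrite christoffel_lrr // eqxx mul1r.
rewrite ddw // big_split_ord /=.
rewrite (eq_bigr (fun l => (christoffel GB i j l (lsubmx u) *
  partial l w (lsubmx u)) / w (lsubmx u))); last first.
  move=> l _; rewrite christoffel_rlr // christoffel_lll // christoffel_llr //.
  by rewrite eqxx /=; ring.
rewrite -mulr_suml (bigD1 c) //= [X in _ + (_ + X)]big1 ?addr0; last first.
  move=> b bc; rewrite christoffel_llr // christoffel_lrr // eq_sym (negbTE bc).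
  by rewrite !mul0r mulr0 subr0.
rewrite christoffel_llr // !christoffel_lrr // eqxx /hessian /=; by field.
Qed.

(** For each fibre index k the quadratic terms are (d_i w / w) (Gamma^k_ka - Gamma^k_ak), and cancel
    by symmetry of the fibre symbols. *)
Lemma ricci_warped_lr i a u : UV u -> ricci_coord G u (l_ i) (r_ a) = 0.
Proof.
move=> uv; have [Uu Vu] := uv.
rewrite !mxE big_split_ord /= !big1 ?addr0 // => k _.
  rewrite (eq_partial_l0 _ (g := fun v => (k == a)%:R *
     (partial i w v / w v))) //; last by move=> v; exact: christoffel_lrr.
  rewrite (eq_partial_l0 _ (g := fun v => (k == k)%:R *
     (partial i w v / w v))) //; last by move=> v; exact: christoffel_lrr.
  rewrite big_split_ord /= big1 ?add0r ?subr0; last first.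
    by move=> l _; rewrite !christoffel_lrl // !mulr0 subr0.
  rewrite sumrB (bigD1 a) //= big1 ?addr0; last first.
    move=> b ba; rewrite [X in _ * X]christoffel_lrr // (negbTE ba).
    by rewrite mul0r mulr0.
  rewrite (bigD1 k) //= big1 ?addr0; last first.
    move=> b ba; rewrite [X in _ * X]christoffel_lrr // (negbTE ba).
    by rewrite mul0r mulr0.
  rewrite !christoffel_rrr // !christoffel_lrr // !eqxx.
  by rewrite (christoffelC oV sF a k _ Vu) subrr addr0 oppr0.
rewrite (@eq_partial_cst _ _ 0) //; last by move=> v; exact: christoffel_lrl.
rewrite (eq_partial_l0 _ (g := christoffel GB i k k)) //; last first.
  by move=> v; exact: christoffel_lll.
rewrite big_split_ord /= !big1 ?addr0 ?subr0 // => L _.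
  by rewrite christoffel_lrl // christoffel_llr // mulr0 mul0r subr0.
by rewrite !christoffel_lrl // christoffel_rll // mulr0 mul0r subr0.
Qed.

(** Symmetry of [ricci_coord] is not visible in its formula, where d_j Gamma^k_ik treats i and j
    differently, so this block is computed like its transpose. *)
Lemma ricci_warped_rl i a u : UV u -> ricci_coord G u (r_ a) (l_ i) = 0.
Proof.
move=> uv; have [Uu Vu] := uv.
rewrite !mxE big_split_ord /= !big1 ?addr0 // => k _.
  rewrite (eq_partial_l0 _ (g := fun v => (k == a)%:R *
     (partial i w v / w v))) //; last by move=> v; exact: christoffel_rlr.
  rewrite (eq_partial_r0 _ (g := christoffel GF a k k)) //; last first.
    by move=> v; exact: christoffel_rrr.
  rewrite big_split_ord /= big1 ?add0r ?subr0; last first.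
    by move=> l _; rewrite christoffel_rll // christoffel_llr // mulr0 mul0r subr0.
  rewrite sumrB (bigD1 a) //= big1 ?addr0; last first.
    move=> b ba; rewrite [X in _ * X]christoffel_rlr // (negbTE ba).
    by rewrite mul0r mulr0.
  rewrite (bigD1 k) //= big1 ?addr0; last first.
    move=> b ba; rewrite christoffel_lrr // eq_sym (negbTE ba).
    by rewrite !mul0r.
  rewrite !christoffel_rrr // christoffel_lrr // christoffel_rlr // !eqxx.
  by rewrite (christoffelC oV sF a k _ Vu) [in X in X - _]mulrC subrr addr0 oppr0.
rewrite (@eq_partial_cst _ _ 0) //; last by move=> v; exact: christoffel_rll.
rewrite (@eq_partial_cst _ _ 0) //; last by move=> v; exact: christoffel_rll.
rewrite big_split_ord /= !big1 ?addr0 ?subr0 // => L _.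
  by rewrite !christoffel_lrl // !mul0r subr0.
by rewrite !christoffel_rll // !mulr0 subr0.
Qed.

(** The base indices k yield w times the Laplacian: the term - d_k w grad^k w, from differentiating
    w grad^k w, cancels against Gamma^k_ba Gamma^a_ak. Besides its share of the Ricci tensor of the
    fibre, an index c contributes (delta_cb - 1) |grad w|^2 g_ab, and the sum over the e values of c
    gives the factor 1 - e. *)
Lemma ricci_warped_rr a b u : UV u ->
  ricci_coord G u (r_ a) (r_ b) = ricci_coord GF (rsubmx u) a b
    - (w (lsubmx u) * laplacian GB w (lsubmx u)
       + (e%:R - 1) * gradient_dot GB w w (lsubmx u)) * GF (rsubmx u) a b.
Proof.
move=> uv; have [Uu Vu] := uv; have w0u := w0 Uu.
set u1 := lsubmx u; set u2 := rsubmx u.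
rewrite !mxE big_split_ord /=.
set g := GF u2 a b.
transitivity (\sum_k (- w u1 * (partial k (gradient GB w k) u1 +
       \sum_l christoffel GB k l k u1 * gradient GB w l u1) * g) +
    \sum_(c < e) ((partial c (christoffel GF a b c) u2
      - partial b (christoffel GF a c c) u2 + \sum_d
       (christoffel GF c d c u2 * christoffel GF a b d u2 -
        christoffel GF b d c u2 * christoffel GF a c d u2)) +
       ((c == b)%:R - 1) * gradient_dot GB w w u1 * g)); last first.
  rewrite [X in _ + X]big_split /=.
  have -> : \sum_(c < e) (((c == b)%:R - 1) * gradient_dot GB w w u1 * g)
      = (1 - e%:R) * gradient_dot GB w w u1 * g :> R.
    rewrite -!mulr_suml sumrB sum_ord_cst mulr1 (bigD1 b) //= eqxx.
    by rewrite big1 ?addr0 // => c /negbTE ->.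
  by rewrite -mulr_suml -mulr_sumr /laplacian; ring.
congr (_ + _).
  apply: eq_bigr => k _.
  rewrite (@eq_partial_lr _ _ (fun v => - (w v * gradient GB w k v))
    (fun v => GF v a b)) //; last 2 first.
  - by apply: smooth_onN => //; exact: smooth_onM.
  - by move=> v; exact: christoffel_rrl.
  rewrite (partialN (U := U)) ?(partialM (U := U)) //; last exact: smooth_onM.
  rewrite (@eq_partial_cst _ _ 0) //; last by move=> v; exact: christoffel_rll.
  rewrite big_split_ord /=.
  rewrite (eq_bigr (fun l => (- w u1 * g) * (christoffel GB k l k u1 *
     gradient GB w l u1))); last first.
    move=> l _; rewrite christoffel_lll // christoffel_rrl // christoffel_rll //.
    by rewrite mul0r subr0 -/u1 -/u2 -/g; ring.
  rewrite -mulr_sumr (bigD1 a) //= [X in _ + (_ + X)]big1 ?addr0; last first.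
    move=> c ca; rewrite christoffel_lrl // christoffel_rlr // (negbTE ca).
    by rewrite !mul0r mulr0 subr0.
  rewrite christoffel_lrl // christoffel_rlr // christoffel_rrl // eqxx /=.
  have -> : GF (rsubmx u) b a = g by rewrite /g -{1}(sF Vu) mxE.
  rewrite -/u1 -/u2 -/g; by field.
apply: eq_bigr => c _.
rewrite (eq_partial_r _ _ (g := christoffel GF a b c)) //; last first.
  by move=> v; exact: christoffel_rrr.
rewrite (eq_partial_r _ _ (g := christoffel GF a c c)) //; last first.
  by move=> v; exact: christoffel_rrr.
rewrite big_split_ord /= -!addrA; congr (_ + (_ + _)).
rewrite addrC; congr (_ + _).
  by apply: eq_bigr => l _; rewrite !christoffel_rrr.
rewrite /gradient_dot mulr_sumr mulr_suml; apply: eq_bigr => l _.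
rewrite christoffel_rlr // christoffel_rlr // !christoffel_rrl // eqxx eq_sym.
rewrite -/u1 -/u2; case: eqVneq => [->|_]; rewrite -/g /=; by field.
Qed.

(** * Functions pulled back from the base *)

Variable f : 'rV[R]_d -> R.
Hypothesis Sf : smooth_on U f.

Let fl (u : 'rV[R]_(d + e)) : R := f (lsubmx u).

Lemma gradient_warped_l k u : UV u ->
  gradient G fl (l_ k) u = gradient GB f k (lsubmx u).
Proof.
move=> uv; rewrite /gradient big_split_ord /= [X in _ + X]big1 ?addr0.
  by apply: eq_bigr => l _; rewrite iGll // partial_lsubmx.
by move=> c _; rewrite iGlr // mul0r.
Qed.

Lemma gradient_warped_r c u : UV u -> gradient G fl (r_ c) u = 0.
Proof.
move=> uv; rewrite /gradient big_split_ord /= !big1 ?addr0 // => l _.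
  by rewrite partial_lsubmx0 mulr0.
by rewrite iGrl // mul0r.
Qed.

Lemma gradient_dot_warped (h : 'rV[R]_d -> R) u : UV u ->
  gradient_dot G fl (fun v => h (lsubmx v)) u = gradient_dot GB f h (lsubmx u).
Proof.
move=> uv; rewrite /gradient_dot big_split_ord /= [X in _ + X]big1 ?addr0.
  by apply: eq_bigr => l _; rewrite gradient_warped_l // partial_lsubmx.
by move=> c _; rewrite gradient_warped_r // mul0r.
Qed.

(** The gradient is tangent to the base, but its divergence also picks up Gamma^c_cl = d_l w / w
    from each of the e fibre directions. *)
Lemma laplacian_warped u : UV u -> laplacian G fl u =
  laplacian GB f (lsubmx u)
  + e%:R / w (lsubmx u) * gradient_dot GB f w (lsubmx u).
Proof.
move=> uv; rewrite /laplacian big_split_ord /=; congr (_ + _).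
  apply: eq_bigr => k _; rewrite (eq_partial_l _ _ (g := gradient GB f k)) //.
    congr (_ + _); rewrite big_split_ord /= [X in _ + X]big1 ?addr0.
      by apply: eq_bigr => l _; rewrite gradient_warped_l // christoffel_lll.
    by move=> c _; rewrite gradient_warped_r // mulr0.
  by move=> v; exact: gradient_warped_l.
transitivity (\sum_(c < e) (gradient_dot GB f w (lsubmx u) / w (lsubmx u))).
  apply: eq_bigr => c _.
  rewrite (@eq_partial_cst _ _ 0) //; last by move=> v; exact: gradient_warped_r.
  rewrite add0r big_split_ord /= [X in _ + X]big1 ?addr0; last first.
    by move=> b _; rewrite gradient_warped_r // mulr0.
  rewrite /gradient_dot mulr_suml; apply: eq_bigr => l _.
  by rewrite gradient_warped_l // christoffel_rlr // eqxx /=; ring.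
by rewrite sum_ord_cst; ring.
Qed.

Lemma hessian_warped_ll i j u : UV u ->
  hessian G fl (l_ i) (l_ j) u = hessian GB f i j (lsubmx u).
Proof.
move=> uv; rewrite /hessian (eq_partial_l _ _ (g := partial i f)) //; last first.
  by move=> v _; rewrite partial_lsubmx.
rewrite big_split_ord /= [X in _ - (_ + X)]big1 ?addr0; last first.
  by move=> c _; rewrite partial_lsubmx0 mulr0.
rewrite (eq_bigr (fun l => christoffel GB i j l (lsubmx u)
  * partial l f (lsubmx u))) // => l _.
by rewrite christoffel_lll // partial_lsubmx.
Qed.

Lemma hessian_warped_lr i a u : UV u -> hessian G fl (l_ i) (r_ a) u = 0.
Proof.
move=> uv; rewrite /hessian (eq_partial_l0 _ (g := partial i f)) //; last first.
  by move=> v _; rewrite partial_lsubmx.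
rewrite big_split_ord /= !big1 ?addr0 ?subr0 // => l _.
  by rewrite partial_lsubmx0 mulr0.
by rewrite christoffel_lrl // mul0r.
Qed.

Lemma hessian_warped_rl i a u : UV u -> hessian G fl (r_ a) (l_ i) u = 0.
Proof.
move=> uv; rewrite /hessian (@eq_partial_cst _ _ 0) //; last first.
  by move=> v _; rewrite partial_lsubmx0.
rewrite big_split_ord /= !big1 ?addr0 ?subr0 // => l _.
  by rewrite partial_lsubmx0 mulr0.
by rewrite christoffel_rll // mul0r.
Qed.

(** A function constant along the fibres still has a Hessian there, because Gamma^l_ab has base
    components. *)
Lemma hessian_warped_rr a b u : UV u -> hessian G fl (r_ a) (r_ b) u =
  w (lsubmx u) * gradient_dot GB w f (lsubmx u) * GF (rsubmx u) a b.
Proof.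
move=> uv; rewrite /hessian (@eq_partial_cst _ _ 0) //; last first.
  by move=> v _; rewrite partial_lsubmx0.
rewrite big_split_ord /= [X in _ - (_ + X)]big1 ?addr0; last first.
  by move=> c _; rewrite partial_lsubmx0 mulr0.
rewrite sub0r -sumrN /gradient_dot mulr_sumr mulr_suml; apply: eq_bigr => l _.
by rewrite christoffel_rrl // partial_lsubmx; ring.
Qed.

End WarpedMetric.

(** * Conformally flat metrics *)

Section KroneckerSums.
Variables (R : realType) (n : nat) (F : 'I_n -> R) (j : 'I_n).

Lemma sum_deltal : \sum_k (k == j)%:R * F k = F j.
Proof.
rewrite (bigD1 j) //= eqxx mul1r big1 ?addr0 // => k /negbTE ->.
by rewrite mul0r.
Qed.

Lemma sum_deltar : \sum_k (j == k)%:R * F k = F j.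
Proof. by rewrite -[RHS]sum_deltal; apply: eq_bigr => k _; rewrite eq_sym. Qed.

End KroneckerSums.

Section ConformallyFlat.
Variables (R : realType) (n : nat) (eps alpha : 'rV[R]_n) (I : set R).
Variables (phi : R -> R) (G : 'rV[R]_n -> 'M[R]_n).
Hypothesis oI : open I.
Hypothesis Heps : forall i, eps 0 i = 1 \/ eps 0 i = -1.
Hypothesis Sphi : smooth1_on I phi.
Hypothesis phi0 : forall t, I t -> phi t != 0.

Local Notation xi := (linear_form alpha).
Let U : set 'rV[R]_n := [set u | I (xi u)].

Hypothesis GE : forall u, U u -> G u = (phi (xi u) ^+ 2)^-1 *: diag_mx eps.

Local Notation E := (\sum_i eps 0 i * alpha 0 i ^+ 2).
Local Notation "g '^(1)'" := (derive1 g) (at level 2, format "g '^(1)'").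

Let oU : open U. Proof. exact: open_linear_form. Qed.

Let eps2 i : eps 0 i * eps 0 i = 1.
Proof. by case: (Heps i) => ->; rewrite ?mulr1 // mulrNN mulr1. Qed.

Lemma smooth_on_xi (g : R -> R) : smooth1_on I g -> smooth_on U (fun u => g (xi u)).
Proof. exact: smooth_on_linear_form. Qed.

Lemma partial_xi (g : R -> R) i u : smooth1_on I g -> U u ->
  partial i (fun v => g (xi v)) u = alpha 0 i * g^(1) (xi u).
Proof. by move=> Sg Uu; apply: partial_linear_form; exact: (Sg 0%N). Qed.

Let Sp : smooth_on U (fun u => (phi (xi u) ^+ 2)^-1).
Proof.
apply: smooth_onV => //; first by move=> u Uu; rewrite expf_neq0 // phi0.
by apply: smooth_onX => //; exact: smooth_on_xi.
Qed.

Let dphi2 i u : U u -> partial i (fun u => phi (xi u) ^+ 2) u =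
  alpha 0 i * (2 * phi (xi u) * phi^(1) (xi u)).
Proof.
move=> Uu; have Sx := smooth_on_xi Sphi.
rewrite (_ : (fun u => _) = fun u => phi (xi u) * phi (xi u)); last first.
  by apply/funext => v; rewrite expr2.
by rewrite (partialM (U := U)) // partial_xi //; ring.
Qed.

Let dp i u : U u -> partial i (fun u => (phi (xi u) ^+ 2)^-1) u =
  alpha 0 i * (-2 * phi^(1) (xi u) / phi (xi u) ^+ 3).
Proof.
move=> Uu; have p0 := phi0 Uu.
rewrite (partialV (U := U)) ?expf_neq0 //; last first.
  by apply: smooth_onX => //; exact: smooth_on_xi.
by rewrite dphi2 //; field.
Qed.

Lemma conformally_flatE u i j : U u ->
  G u i j = (phi (xi u) ^+ 2)^-1 * (eps 0 i * (i == j)%:R).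
Proof. by move=> Uu; rewrite GE // !mxE mulr_natr. Qed.

Lemma smooth_on_conformally_flat i j : smooth_on U (fun u => G u i j).
Proof.
apply: (eq_smooth_on (f := fun u => (phi (xi u) ^+ 2)^-1 *
   (eps 0 i * (i == j)%:R))) => //.
  by move=> u Uu; rewrite conformally_flatE.
by apply: smooth_onM => //; exact: smooth_on_cst.
Qed.

Let invGE u : U u -> invmx (G u) = phi (xi u) ^+ 2 *: diag_mx eps
  /\ G u \in unitmx.
Proof.
move=> Uu; have p0 := phi0 Uu.
have GV : G u *m (phi (xi u) ^+ 2 *: diag_mx eps) = 1%:M.
  rewrite GE // -scalemxAl -scalemxAr scalerA mulVf ?expf_neq0 // scale1r.
  apply/matrixP => i j; rewrite mul_diag_mx !mxE.
  by case: eqVneq => [->|_]; rewrite ?mulr0 // mulr1n eps2.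
have [uG _] := mulmx1_unit GV.
by split=> //; rewrite -[RHS](mulKmx uG) GV mulmx1.
Qed.

Lemma unitmx_conformally_flat u : U u -> G u \in unitmx.
Proof. by case/invGE. Qed.

Let iG u k l : U u -> invmx (G u) k l =
  (l == k)%:R * (phi (xi u) ^+ 2 * eps 0 k).
Proof.
by move=> /invGE[-> _]; rewrite !mxE eq_sym; case: eqVneq => _;
  rewrite ?mulr0 ?mul0r // mul1r mulr1n.
Qed.

Let dG k i j u : U u -> partial k (fun v => G v i j) u =
  alpha 0 k * (-2 * phi^(1) (xi u) / phi (xi u) ^+ 3) * (eps 0 i * (i == j)%:R).
Proof.
move=> Uu; rewrite (eq_partial _ oU Uu (g := fun u => (phi (xi u) ^+ 2)^-1 *
  (eps 0 i * (i == j)%:R))); last by move=> v Uv; rewrite conformally_flatE.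
rewrite (partialM (U := U)) //; last exact: smooth_on_cst.
by rewrite partial_cst mulr0 add0r dp.
Qed.

(** The Christoffel symbols are this constant array times - phi'/phi. All dependence on the point
    sits in that scalar, and the contractions below become identities in alpha and eps alone. *)
Let C i j k : R := alpha 0 i * (k == j)%:R + alpha 0 j * (k == i)%:R
  - alpha 0 k * eps 0 k * eps 0 i * (i == j)%:R.

Let christoffelE i j k u : U u -> christoffel G i j k u =
  phi^(1) (xi u) / phi (xi u) * - C i j k.
Proof.
move=> Uu; have p0 := phi0 Uu; rewrite /christoffel.
rewrite (eq_bigr (fun l => (l == k)%:R * (phi (xi u) ^+ 2 * eps 0 k *
  (partial i (fun w => G w j l) u + partial j (fun w => G w i l) u -
     partial l (fun w => G w i j) u)))); last by move=> l _; rewrite iG //; ring.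
rewrite sum_deltal !dG // /C.
transitivity (phi^(1) (xi u) / phi (xi u) *
  - (alpha 0 i * (eps 0 k * eps 0 j * (j == k)%:R)
  + alpha 0 j * (eps 0 k * eps 0 i * (i == k)%:R)
  - alpha 0 k * eps 0 k * eps 0 i * (i == j)%:R)); first by field.
have ek l : eps 0 k * eps 0 l * (l == k)%:R = (k == l)%:R.
  by rewrite eq_sym; case: eqVneq => [->|_]; rewrite ?mulr0 // eps2 mulr1.
by rewrite !ek.
Qed.

Let Sq : smooth_on U (fun u => phi^(1) (xi u) / phi (xi u)).
Proof.
apply: smooth_onM => //; first exact/smooth_on_xi/smooth1_on_derive1.
by apply: smooth_onV => //; [move=> u; exact: phi0|exact: smooth_on_xi].
Qed.

Let dq i u : U u -> partial i (fun u => phi^(1) (xi u) / phi (xi u)) u =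
  alpha 0 i * (phi^(1)^(1) (xi u) / phi (xi u)
    - (phi^(1) (xi u) / phi (xi u)) ^+ 2).
Proof.
move=> Uu; have p0 := phi0 Uu; have Sd := smooth1_on_derive1 Sphi.
have Sx := smooth_on_xi Sphi; have Sdx := smooth_on_xi Sd.
rewrite (partialM (U := U)) ?(partialV (U := U)) //; last first.
  by apply: smooth_onV => // v; exact: phi0.
by rewrite !partial_xi //; field.
Qed.

Let dchristoffel m i j k u : U u -> partial m (christoffel G i j k) u =
  alpha 0 m * (phi^(1)^(1) (xi u) / phi (xi u)
    - (phi^(1) (xi u) / phi (xi u)) ^+ 2) * - C i j k.
Proof.
move=> Uu; rewrite (eq_partial _ oU Uu (g := fun u => phi^(1) (xi u) / phi (xi u) *
   - C i j k)); last by move=> v Uv; rewrite christoffelE.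
rewrite (partialM (U := U)) //; last exact: smooth_on_cst.
by rewrite partial_cst mulr0 add0r dq.
Qed.

Let sum_alphaC i j : \sum_k alpha 0 k * C i j k =
  2 * alpha 0 i * alpha 0 j - E * (eps 0 i * (i == j)%:R).
Proof.
transitivity (\sum_k (k == j)%:R * (alpha 0 i * alpha 0 k) +
  \sum_k (k == i)%:R * (alpha 0 j * alpha 0 k) +
  \sum_k (eps 0 k * alpha 0 k ^+ 2) * - (eps 0 i * (i == j)%:R)).
  by rewrite -!big_split; apply: eq_bigr => k _ /=; rewrite /C; ring.
by rewrite !sum_deltal -mulr_suml; ring.
Qed.

(** No summation over k is involved: when k = i the last two terms of [C] cancel since eps_i^2 = 1.
    The traces of the Christoffel symbols are thus n equal terms. *)
Let C_diag i k : C i k k = alpha 0 i.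
Proof.
rewrite /C eqxx mulr1; case: eqVneq => [->|_]; last by rewrite !mulr0 subr0 addr0.
by rewrite !mulr1 -[_ * _ * eps 0 i]mulrA eps2 mulr1 addrK.
Qed.

Let CC i j k : C i j k = C j i k.
Proof.
rewrite /C [alpha 0 i * _ + _]addrC; congr (_ - _); rewrite [in RHS]eq_sym.
by case: eqVneq => [->|_]; rewrite // !mulr0.
Qed.

(** The quadratic contraction of the Ricci tensor. Expanding only the first factor reduces the inner
    sums to Kronecker sums and to [sum_alphaC]. *)
Let sum_CC i j : \sum_k \sum_l C j l k * C i k l =
  (n%:R + 2) * alpha 0 i * alpha 0 j - 2 * E * (eps 0 i * (i == j)%:R).
Proof.
transitivity (\sum_k (alpha 0 i * alpha 0 j +
  (k == j)%:R * (2 * alpha 0 i * alpha 0 k) -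
  (k == i)%:R * ((k == j)%:R * (E * eps 0 i)) -
  ((k == j)%:R * (alpha 0 k * eps 0 k * eps 0 j * alpha 0 i)
   + eps 0 k * alpha 0 k ^+ 2 * (eps 0 j * (j == i)%:R)
   - (k == i)%:R * (alpha 0 k * eps 0 k * eps 0 j * alpha 0 j * eps 0 j * eps 0 i)))).
  apply: eq_bigr => k _.
  transitivity (\sum_l (l == k)%:R * (alpha 0 j * C i k l) +
    \sum_l (k == j)%:R * (alpha 0 l * C i k l) -
    \sum_l (j == l)%:R * (alpha 0 k * eps 0 k * eps 0 j * C i k l)).
    rewrite -sumrN -!big_split; apply: eq_bigr => l _ /=.
    rewrite {1}/C (eq_sym k l); ring.
  rewrite sum_deltal sum_deltar -mulr_sumr sum_alphaC C_diag /C (eq_sym i k).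
  rewrite (eq_sym j k) ; ring.
rewrite !(big_split, sumrN) /= !sum_deltal sum_ord_cst.
rewrite -mulr_suml.
have eij : eps 0 j * (j == i)%:R = eps 0 i * (i == j)%:R.
  by rewrite eq_sym; case: eqVneq => [->|_]; rewrite // !mulr0.
have -> : alpha 0 j * eps 0 j * eps 0 j * alpha 0 i = alpha 0 j * alpha 0 i.
  by rewrite -[alpha 0 j * _ * _]mulrA eps2 mulr1.
have -> : alpha 0 i * eps 0 i * eps 0 j * alpha 0 j * eps 0 j * eps 0 i =
    alpha 0 i * alpha 0 j * (eps 0 i * eps 0 i) * (eps 0 j * eps 0 j) by ring.
rewrite !eps2 eij; ring.
Qed.

(** The classical formula (n - 2) Hess phi / phi + (Lap phi / phi - (n - 1) |grad phi|^2 / phi^2) g,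
    with operators taken for the flat g. For phi(xi) the flat Hessian is alpha_i alpha_j phi'', and
    the flat Laplacian and squared gradient carry the factor sum_i eps_i alpha_i^2. *)
Lemma ricci_conformally_flat i j u : U u -> let t := xi u in
  ricci_coord G u i j =
  (n%:R - 2) * (alpha 0 i * alpha 0 j) * (phi^(1)^(1) t / phi t)
  + E * (phi^(1)^(1) t / phi t - (n%:R - 1) * (phi^(1) t / phi t) ^+ 2)
      * (eps 0 i * (i == j)%:R).
Proof.
move=> Uu t; rewrite mxE.
pose q := phi^(1) t / phi t; pose dq' := phi^(1)^(1) t / phi t - q ^+ 2.
transitivity (\sum_k (- dq' * (alpha 0 k * C i j k)) +
   \sum_(k < n) dq' * alpha 0 i * alpha 0 j +
   \sum_k (\sum_l q ^+ 2 * (alpha 0 l * C i j l) - q ^+ 2 * \sum_l C j l k * C i k l)).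
  rewrite -!big_split; apply: eq_bigr => k _ /=.
  rewrite !dchristoffel // C_diag; congr (_ + _).
    by rewrite -/t -/q -/dq'; ring.
  rewrite mulr_sumr -sumrB; apply: eq_bigr => l _.
  rewrite !christoffelE // (CC k l k) C_diag -/t -/q; ring.
rewrite sumrB sum_ord_cst -!mulr_sumr sum_alphaC !sum_ord_cst sum_CC /dq' -/q.
ring.
Qed.

(** * Gradient, Hessian and Laplacian of functions of xi *)

Section RadialFunctions.
Variables (f h : R -> R).
Hypotheses (Sf : smooth1_on I f) (Sh : smooth1_on I h).

Let fx (u : 'rV[R]_n) : R := f (xi u).

Lemma gradient_radial k u : U u ->
  gradient G fx k u = phi (xi u) ^+ 2 * f^(1) (xi u) * (eps 0 k * alpha 0 k).
Proof.
move=> Uu; rewrite /gradient (eq_bigr (fun l => (l == k)%:R *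
  (phi (xi u) ^+ 2 * eps 0 k * (alpha 0 l * f^(1) (xi u))))).
  by rewrite sum_deltal; ring.
by move=> l _; rewrite iG // partial_xi //; ring.
Qed.

Lemma gradient_dot_radial u : U u ->
  gradient_dot G fx (fun v => h (xi v)) u =
  E * (phi (xi u) ^+ 2 * f^(1) (xi u) * h^(1) (xi u)).
Proof.
move=> Uu; rewrite /gradient_dot mulr_suml; apply: eq_bigr => k _.
by rewrite gradient_radial // partial_xi //; ring.
Qed.

Lemma hessian_radial i j u : U u -> let t := xi u in
  hessian G fx i j u =
  alpha 0 i * alpha 0 j * (f^(1)^(1) t + 2 * (phi^(1) t / phi t) * f^(1) t)
  - E * (phi^(1) t / phi t) * f^(1) t * (eps 0 i * (i == j)%:R).
Proof.
move=> Uu t; rewrite /hessian.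
have Sdf := smooth1_on_derive1 Sf.
rewrite (eq_partial _ oU Uu (g := fun u => alpha 0 i * f^(1) (xi u))); last first.
  by move=> v Uv; rewrite partial_xi.
rewrite (partialM (U := U)) //; last 2 first.
- exact: smooth_on_cst.
- exact: smooth_on_xi.
rewrite partial_cst mul0r addr0 partial_xi //.
rewrite (eq_bigr (fun l => - (phi^(1) t / phi t) * f^(1) t *
    (alpha 0 l * C i j l))); last first.
  by move=> l _; rewrite christoffelE // partial_xi // -/t; ring.
by rewrite -mulr_sumr sum_alphaC -/t; ring.
Qed.

Lemma laplacian_radial u : U u -> let t := xi u in
  laplacian G fx u =
  E * phi t ^+ 2 * (f^(1)^(1) t - (n%:R - 2) * (phi^(1) t / phi t) * f^(1) t).
Proof.
move=> Uu t; have p0 : phi t != 0 by exact: phi0.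
have Sdf := smooth1_on_derive1 Sf.
rewrite /laplacian big_split /= exchange_big /=.
(* The factor n - 2 arises from the n equal traces of the Christoffel symbols, less the 2 from
   differentiating phi^2 in the gradient. *)
transitivity (\sum_k (eps 0 k * alpha 0 k ^+ 2) *
   (phi t ^+ 2 * f^(1)^(1) t + 2 * phi t * phi^(1) t * f^(1) t) +
   \sum_k (eps 0 k * alpha 0 k ^+ 2) * (- n%:R * phi t * phi^(1) t * f^(1) t)).
  congr (_ + _); apply: eq_bigr => k _.
    rewrite (eq_partial _ oU Uu (g := fun u => phi (xi u) ^+ 2 *
      (f^(1) (xi u) * (eps 0 k * alpha 0 k)))); last first.
      by move=> v Uv; rewrite gradient_radial // -mulrA.
    have Sc := smooth_on_cst U (eps 0 k * alpha 0 k).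
    have Sphi2 : smooth_on U (fun u => phi (xi u) ^+ 2).
      by apply: smooth_onX => //; exact: smooth_on_xi.
    have Sdfx := smooth_on_xi Sdf.
    rewrite (partialM _ Sphi2 (smooth_onM oU Sdfx Sc) Uu) (partialM _ Sdfx Sc Uu).
        by rewrite dphi2 // partial_cst partial_xi // -/t; ring.
  rewrite (eq_bigr (fun=> - (phi^(1) t / phi t) * alpha 0 k *
     (phi t ^+ 2 * f^(1) t * (eps 0 k * alpha 0 k)))); last first.
    move=> l _; rewrite christoffelE // gradient_radial // (CC l k l) C_diag.
    by rewrite -/t; ring.
  by rewrite sum_ord_cst; field.
by rewrite -!mulr_suml; field.
Qed.

End RadialFunctions.

End ConformallyFlat.

(** * The ordinary differential equations *)

Section LimitOfDerivative.
Variable R : realType.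

(** Since the difference quotients at t are known to converge, chords arbitrarily close to t
    determine their limit, even if these chords all lie on one side. Continuity of psi identifies
    it. *)
Lemma derive1_eq_of_chords (y psi : R -> R) (t : R) :
  derivable y t 1 -> {for t, continuous psi} ->
  (forall d : R, 0 < d -> exists s u, [/\ 0 < `|s - t| < d, `|u - t| < d &
     y s - y t = psi u * (s - t)]) ->
  derive1 y t = psi t.
Proof.
move=> dy cpsi chord; apply/eqP; rewrite -subr_eq0 -normr_eq0 eq_le normr_ge0 andbT.
apply/ler_addgt0Pl => e e0; rewrite addr0.
have e20 : 0 < e / 2 by rewrite divr_gt0.
have /cvgrPdist_lt/(_ _ e20)/nbhs_ballP[d1 /= d10 Hd1] := cpsi.
have /cvgrPdist_lt/(_ _ e20)[d2 /= d20 Hd2] :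
    h^-1 *: (y (h + t) - y t) @[h --> 0^'] --> derive1 y t.
  move: dy; rewrite /derivable (_ : (fun h => _) = fun h => h^-1 *: (y (h + t) - y t)) //.
  by apply/funext => h /=; rewrite [h *: 1]mulr1.
have [s [u [/andP[st0 std] utd stE]]] :=
  chord (Num.min d1 d2) ltac:(by rewrite lt_min d10).
move: std utd; rewrite !lt_min => /andP[_ std2] /andP[utd1 _].
have := Hd1 u; rewrite /ball /= distrC => /(_ utd1) P1.
have st_neq0 : s - t != 0 by rewrite -normr_gt0.
have := Hd2 (s - t); rewrite /ball /= sub0r normrN => /(_ std2 st_neq0).
rewrite subrK stE /GRing.scale /= mulrC mulfK // => P2.
rewrite (_ : _ - _ = (derive1 y t - psi u) + (psi u - psi t)); last by ring.
apply: (le_trans (ler_normD _ _)).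
by rewrite [leRHS]splitr lerD // ltW // distrC.
Qed.

Lemma MVT_chord (y : R -> R) (s t : R) : s < t ->
  (forall u, s <= u <= t -> derivable y u 1) ->
  exists2 u, s < u < t & y t - y s = derive1 y u * (t - s).
Proof.
move=> st dy.
have [||u ut e] := @MVT R y (derive1 y) s t st.
- move=> u; rewrite in_itv /= => /andP[su ut].
  have du : derivable y u 1 by apply: dy; rewrite !ltW.
  by rewrite derive1E; exact/derivableP.
- apply: derivable_within_continuous => u; rewrite in_itv /=; exact: dy.
by exists u => //; move: ut; rewrite in_itv.
Qed.

Lemma continuous_gt0 (y : R -> R) (t : R) : {for t, continuous y} -> 0 < y t ->
  exists2 d : R, 0 < d & forall s, `|s - t| < d -> 0 < y s.
Proof.
move=> cy yt; have /cvgrPdist_lt/(_ _ yt)/nbhs_ballP[d /= d0 Hd] := cy.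
exists d => // s sd; have := Hd s; rewrite /ball /= distrC => /(_ sd).
by move=> /(le_lt_trans (ler_norm _)); rewrite ltrBlDr ltrDl.
Qed.

Lemma derivable_continuous (y : R -> R) (t : R) :
  derivable y t 1 -> {for t, continuous y}.
Proof. by move=> /derivable1_diffP; exact: differentiable_continuous. Qed.

Lemma itv_derive1_0_eq (I : set R) (y : R -> R) : is_interval I ->
  (forall t, I t -> derivable y t 1) -> (forall t, I t -> derive1 y t = 0) ->
  forall s t, I s -> I t -> y s = y t.
Proof.
move=> Ii dy y0; suff H s t : I s -> I t -> s < t -> y s = y t.
  by move=> s t Is It; have [/H->|/H->|->] := ltgtP s t.
move=> Is It st; have [u su|u /andP[su ut] /eqP] := @MVT_chord y _ _ st.
  by apply: dy; apply: Ii su.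
rewrite y0 ?mul0r; first by rewrite subr_eq0 => /eqP.
by apply: (Ii s t) => //; rewrite !ltW.
Qed.

End LimitOfDerivative.

(** * Zeros crossed with a prescribed positive slope *)

Section Transversality.
Variable R : realType.

Section Monotone.
Variables (I : set R) (y psi : R -> R).
Hypothesis Ii : is_interval I.
Hypothesis dy : forall t, I t -> derivable y t 1.
Hypothesis cpsi : forall t, I t -> {for t, continuous psi}.
Hypothesis psi0 : forall t, I t -> 0 < psi t.
Hypothesis yE : forall t, I t -> y t != 0 -> derive1 y t = psi t.

(* The derivative of [y ^+ 3] is nonnegative also where nothing is known of
   the derivative of [y]. *)
Lemma transversal_ndecr s t : I s -> I t -> s <= t -> y s <= y t.
Proof.
move=> Is It; rewrite le_eqVlt => /predU1P[->//|st].
have Iu u : s <= u <= t -> I u by exact: Ii.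
have d3 u : I u -> is_derive u 1 (fun v => y v ^+ 3) (3 * y u ^+ 2 * derive1 y u).
  move=> /dy/derivableP Dy; rewrite derive1E.
  have -> : (fun v => y v ^+ 3) = y ^+ 3 by apply/funext => v.
  by apply: is_derive_eq; rewrite /GRing.scale /= -mulr_natl; ring.
have [u su|u /andP[su ut]] := @MVT_chord _ (fun v => y v ^+ 3) _ _ st.
  by have [] := d3 u (Iu _ su).
have {}Iu' : I u by apply: Iu; rewrite !ltW.
rewrite derive1E (@derive_val _ _ _ _ _ _ _ (d3 u Iu')) => e.
have {e} : 0 <= y t ^+ 3 - y s ^+ 3.
  rewrite e mulr_ge0 ?subr_ge0 ?(ltW st) //.
  have [->|y0] := eqVneq (y u) 0; first by rewrite expr0n /= mulr0 mul0r.
  rewrite yE //; apply: mulr_ge0; last exact: ltW (psi0 Iu').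
  by apply: mulr_ge0; rewrite ?sqr_ge0.
have [//|yts] := leP (y s) (y t).
rewrite leNgt => /negP[]; rewrite -oppr_gt0.
(* This form of the difference of cubes makes its sign that of y s - y t. *)
have -> : - (y t ^+ 3 - y s ^+ 3) =
    ((y s - y t) ^+ 3 + 3 * (y s - y t) * (y s + y t) ^+ 2) / 4 by field.
rewrite divr_gt0 // ltr_pwDl // ?exprn_gt0 ?subr_gt0 //.
by rewrite mulr_ge0 ?sqr_ge0 // mulr_ge0 // subr_ge0 ltW.
Qed.

(** By monotonicity y is negative from t0 up to its first zero s, and vanishes on [s, b]. The
    derivative at s would then be 0 seen from the right and psi s > 0 seen from the left. *)
Lemma transversal_left t0 a b : I t0 -> I b -> t0 < a -> a < b ->
  y t0 != 0 -> y a = 0 -> y b = 0 -> False.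
Proof.
move=> It0 Ib t0a ab yt0 ya yb.
have Iin u : t0 <= u <= b -> I u by exact: Ii.
have Ia : I a by apply: Iin; rewrite !ltW.
have yt0_lt : y t0 < 0.
  by rewrite lt_neqAle yt0 -ya transversal_ndecr // ltW.
pose S := [set u | t0 <= u <= a /\ y u < 0].
have St0 : S t0 by split=> //; rewrite lexx ltW.
have hS : has_sup S.
  by split; [exists t0|exists a => u [/andP[]]].
(* The first zero of y: were y s negative, continuity would put points of [S] beyond its
   supremum. *)
pose s := sup S.
have t0s : t0 <= s by apply: sup_upper_bound.
have sa : s <= a by apply: sup_le_ub; [exists t0|move=> u [/andP[]]].
have sb : s < b by exact: le_lt_trans ab.
have Is : I s by apply: Iin; rewrite t0s ltW.
have ys : y s = 0.
  apply/eqP; rewrite eq_le -{1}ya transversal_ndecr //= leNgt; apply/negP => ys.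
  have cNy : {for s, continuous (fun u => - y u)}.
    by apply: cvgN; apply: derivable_continuous; exact: dy.
  have [|d d0 Hd] := continuous_gt0 cNy; first by rewrite oppr_gt0.
  have sa' : s < a.
    by rewrite lt_neqAle sa andbT; apply: contraTneq ys => ->; rewrite ya ltxx.
  pose u := Num.min a (s + d / 2).
  have su : s < u by rewrite lt_min sa' ltrDl divr_gt0.
  suff /(sup_upper_bound hS) : S u by rewrite leNgt su.
  split; first by rewrite (le_trans t0s (ltW su)) ge_min lexx.
  rewrite -oppr_gt0; apply: Hd; rewrite gtr0_norm ?subr_gt0 // ltrBlDr.
  by rewrite gt_min; apply/orP; right; rewrite addrC ltrD2r; lra.
have yneg u : t0 <= u -> u < s -> y u < 0.
  move=> t0u us; have us0 : 0 < s - u by rewrite subr_gt0.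
  have [v [/andP[t0v va] yv] uv] := sup_adherent us0 hS.
  rewrite opprB addrCA subrr addr0 in uv.
  apply: le_lt_trans yv; apply: transversal_ndecr; last exact: ltW.
  - by apply: Iin; rewrite t0u ltW // (lt_trans us).
  - by apply: Iin; rewrite t0v (le_trans va) ?ltW.
have t0s' : t0 < s.
  by rewrite lt_neqAle t0s andbT; apply: contraTneq yt0_lt => ->; rewrite ys ltxx.
have yr u : s <= u <= b -> y u = 0.
  move=> /andP[su ub]; have Iu : I u by apply: Iin; rewrite (le_trans t0s).
  by apply/eqP; rewrite eq_le -{1}yb -{1}ys !transversal_ndecr.
(* Chords to the right of s join two zeros of y. *)
have : derive1 y s = 0.
  apply: (@derive1_eq_of_chords _ y (fun=> 0)); first exact: dy.
    exact: cst_continuous.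
  move=> d d0; pose u := Num.min b (s + d / 2); exists u, s.
  have su : s < u by rewrite lt_min sb ltrDl divr_gt0.
  have ud : u < s + d by rewrite gt_min; apply/orP; right; rewrite ltrD2l; lra.
  rewrite subrr normr0 gtr0_norm ?subr_gt0 // su ltrBlDl ud; split=> //.
  by rewrite yr ?(ltW su) ?ge_min ?lexx // ys mul0r subrr.
(* Chords to the left of s have a slope psi v, by the mean value theorem, since y is negative
   there. *)
apply/eqP; rewrite (@derive1_eq_of_chords _ y psi) ?gt_eqF ?psi0 //.
- exact: dy.
- exact: cpsi.
move=> d d0; pose u := Num.max t0 (s - d / 2).
have us : u < s by rewrite gt_max t0s' ltrBlDr ltrDl divr_gt0.
have ud : s - d < u by rewrite lt_max; apply/orP; right; rewrite ltrD2l ltrN2; lra.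
have t0u : t0 <= u by rewrite le_max lexx.
have Iv v : u <= v <= s -> I v.
  by move=> /andP[uv vs]; apply: Iin; rewrite (le_trans t0u) // (le_trans vs) ?ltW.
have [v /Iv/dy//|v /andP[uv vs] e] := @MVT_chord _ y _ _ us.
exists u, v; split.
- by rewrite distrC gtr0_norm ?subr_gt0 // us; lra.
- by rewrite distrC gtr0_norm ?subr_gt0 //; lra.
rewrite -(yE (Iv v _)) ?ltW //; first by rewrite -opprB e; ring.
by rewrite lt_eqF // yneg ?(le_trans t0u) ?ltW.
Qed.

End Monotone.

(* A zero of [y] that is the end of a nonzero stretch is crossed with the slope
   [psi] of that stretch, so the zeros are isolated unless [y] vanishes on all
   of [I]. *)
Lemma transversal_derive1 (I : set R) (y psi : R -> R) :
  open I -> is_interval I ->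
  (forall t, I t -> derivable y t 1) ->
  (forall t, I t -> {for t, continuous psi}) ->
  (forall t, I t -> 0 < psi t) ->
  (forall t, I t -> y t != 0 -> derive1 y t = psi t) ->
  (exists2 t, I t & y t != 0) ->
  forall t, I t -> derive1 y t = psi t.
Proof.
move=> oI Ii dy cpsi psi0 yE [t0 It0 yt0] t It.
have [yt|/yE] := eqVneq (y t) 0; last exact.
(* Replacing y by - y(- u) and psi by psi(- u) preserves all the hypotheses, and carries two zeros
   left of t0 to two zeros right of - t0. *)
have dN u : I (- u) -> is_derive u 1 (fun v => - y (- v)) (derive1 y (- u)).
  move=> /dy/derivableP Dy; rewrite derive1E.
  have := is_derive1_comp Dy (is_deriveNid u 1) => /is_deriveN.
  by move=> H; apply: is_derive_eq; rewrite mulrN1 opprK.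
have right_false a b : I a -> I b -> a < b -> b < t0 -> y a = 0 -> y b = 0 -> False.
  move=> Ia Ib ab bt0 ya yb.
  apply: (@transversal_left [set u | I (- u)] (fun v => - y (- v)) (fun v => psi (- v))
    _ _ _ _ _ (- t0) (- b) (- a)); rewrite /= ?ltrN2 ?opprK ?oppr_eq0 ?oppr0 //.
  - move=> u v Iu Iv w /andP[uw wv]; apply: Ii Iv Iu _ _.
    by rewrite !lerN2 wv.
  - by move=> u /dN[].
  - move=> u Iu; apply: continuous_comp; first exact: opp_continuous.
    exact: cpsi.
  - by move=> u /psi0.
  - move=> u Iu; rewrite oppr_eq0 => yu.
    by rewrite derive1E (@derive_val _ _ _ _ _ _ _ (dN u Iu)) yE.
  - by rewrite yb oppr0.
  - by rewrite ya oppr0.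
have two_false a b : I a -> I b -> a < b -> y a = 0 -> y b = 0 -> False.
  move=> Ia Ib ab ya yb; have [t0a|at0|t0a] := ltgtP t0 a.
  - exact: (@transversal_left I y psi Ii dy cpsi psi0 yE t0 a b).
  - have [t0b|bt0|t0b] := ltgtP t0 b.
    (* Here a < t0 < b, and monotonicity squeezes y t0 between two zeros. *)
    + have nd := @transversal_ndecr I y psi Ii dy psi0 yE.
      by move: yt0; rewrite eq_le -{1}yb -{1}ya !nd //; exact: ltW.
    + exact: (right_false a b).
    by move: yt0; rewrite t0b yb eqxx.
  by move: yt0; rewrite t0a ya eqxx.
(* Thus t is the only zero, and every chord from t to the right has a slope psi v. *)
have yneq u : I u -> u != t -> y u != 0.
  move=> Iu ut; apply/eqP => yu; have [ut'|tu|e] := ltgtP u t.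
  - exact: (two_false u t).
  - exact: (two_false t u).
  - by rewrite e eqxx in ut.
apply: derive1_eq_of_chords; [exact: dy|exact: cpsi|] => d d0.
have /nbhs_ballP[e /= e0 He] : nbhs t I by exact: open_nbhs_nbhs.
pose m := Num.min d e; have m0 : 0 < m by rewrite lt_min d0.
pose u := t + m / 2; have tu : t < u by rewrite ltrDl divr_gt0.
have ud : u < t + d.
  by rewrite ltrD2l; apply: (@lt_le_trans _ _ m); [lra|rewrite ge_min lexx].
have Iv v : t <= v <= u -> I v.
  move=> /andP[tv vu]; apply: He; rewrite /ball /= distrC ger0_norm ?subr_ge0 //.
  rewrite ltrBlDl; apply: (le_lt_trans vu); rewrite ltrD2l.
  by apply: (@lt_le_trans _ _ m); [lra|rewrite ge_min lexx orbT].
have [v /Iv/dy//|v /andP[tv vu] ev] := @MVT_chord _ y _ _ tu.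
exists u, v; rewrite !gtr0_norm ?subr_gt0 // tu; split.
- by rewrite ltrBlDl.
- by rewrite ltrBlDl (lt_trans vu).
have Iv' : I v by apply: Iv; rewrite !ltW.
by rewrite ev yE // yneq // gt_eqF.
Qed.

End Transversality.

(** * Equations for x and z, and derivatives of the warping functions *)

Section WarpingODE.
Variables (R : realType) (n m r : nat) (k c : R) (I : set R).
Variables (f h phi x z V : R -> R).
Hypotheses (hr : (0 < r)%N) (hc : 0 < c).
Hypotheses (oI : open I) (Ii : is_interval I).
Hypotheses (Sf : smooth1_on I f) (Sh : smooth1_on I h) (Sphi : smooth1_on I phi).
Hypothesis Hdom : forall t, I t -> [/\ 0 < f t, 0 < h t & phi t != 0].
Hypothesis Hden : forall t, I t -> v_den n m r k (z t) != 0.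
Hypothesis HV : forall t, I t -> is_derive (z t) 1 V (v_fun n m r k (z t)).
Hypothesis Hzd : forall t, I t -> derivable z t 1.
Hypothesis Hode : forall t, I t ->
  v_fun n m r k (z t) * derive1 z t
  - c * (coef_a n m k - r%:R * z t) * expR (V (z t)) = 0.
Hypothesis Hz : exists t, I t /\ r%:R * z t != coef_a n m k.
Hypothesis Hx : forall t, I t -> x t = c * expR (V (z t)).
Hypothesis Hff : forall t, I t -> derive1 f t / f t = x t.
Hypothesis Hphiphi : forall t, I t -> derive1 phi t / phi t = k * x t.
Hypothesis Hhh : forall t, I t -> derive1 h t / h t = x t * z t.

Local Notation a := (coef_a n m k).
Local Notation D t := (v_den n m r k (z t)).
Local Notation rR := (r%:R : R).

Let r0 : rR != 0. Proof. by rewrite pnatr_eq0 -lt0n. Qed.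

Let eq_on_derive1 (F G : R -> R) (t d : R) : I t -> (forall u, I u -> G u = F u) ->
  is_derive t 1 F d -> is_derive t 1 G d.
Proof.
move=> It GF DF.
have near_FG : {near t, F =1 G}.
  have nI : nbhs t I by exact: open_nbhs_nbhs.
  by apply: filterS nI => u Iu; rewrite GF.
by apply: near_eq_is_derive DF.
Qed.

Let is_derive1 (F : R -> R) (t : R) : derivable F t 1 -> is_derive t 1 F (derive1 F t).
Proof. by move=> dF; rewrite derive1E; exact/derivableP. Qed.

Let derive1_val (F : R -> R) (t d : R) : is_derive t 1 F d -> derive1 F t = d.
Proof. by move=> DF; rewrite derive1E; exact: derive_val. Qed.

Let x_gt0 t : I t -> 0 < x t.
Proof. by move=> It; rewrite Hx // mulr_gt0 // expR_gt0. Qed.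

Let Dx t : I t -> is_derive t 1 x (x t ^+ 2 * (a - rR * z t)).
Proof.
move=> It; apply: (@eq_on_derive1 (fun u => c * expR (V (z u)))) => //.
have Dz := is_derive1 (Hzd It).
have DVz := is_derive1_comp (HV It) Dz.
have De := is_derive1_comp (is_derive_expR (V (z t))) DVz.
apply: is_derive_eq (is_deriveM (is_derive_cst c t 1) De) _.
rewrite scaler0 addr0 Hx // /GRing.scale /=.
(* The chain rule produces the product v(z) z', which the equation replaces as a whole; nothing is
   divided by a - r z. *)
have /eqP := Hode It; rewrite subr_eq0 => /eqP ->; ring.
Qed.

Let DD t : I t -> is_derive t 1 (fun u => D u)
  ((2 * rR * (rR - 1) * z t - 2 * rR * (k + a)) * derive1 z t).
Proof.
move=> It; have Dz := is_derive1 (Hzd It).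
(* Written with ring operations on functions, the polynomial has a derivative that instance
   resolution can find. *)
have -> : (fun u => D u) = cst (rR * (rR - 1)) * (z * z)
    - cst (2 * rR * (k + a)) * z + cst (a ^+ 2 - coef_b n m k).
  by apply/funext => u; rewrite !fctE /v_den; ring.
by apply: is_derive_eq; rewrite /GRing.scale /= !fctE; ring.
Qed.

Let cD t : I t -> {for t, continuous (fun u => D u)}.
Proof. by move=> /DD[+ _]; exact: derivable_continuous. Qed.

(** Intermediate value theorem: D is continuous and has no zero on the interval I. This provides the
    positive slope that the transversality argument requires. *)
Let D_same_sign s t : I s -> I t -> 0 < D s * D t.
Proof.
have H u v : u <= v -> I u -> I v -> 0 < D u * D v.
  move=> uv Iu Iv; rewrite lt_neqAle eq_sym mulf_neq0 ?Hden //= leNgt.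
  apply/negP => DD0.
  have cuv : {within `[u, v], continuous (fun w => D w)}.
    apply: derivable_within_continuous => w; rewrite in_itv /= => uwv.
    by have [] := DD (Ii Iu Iv uwv).
  have [|w] := IVT uv cuv (v := 0).
    have [Du|Du|Du] := ltgtP (D u) 0; last by rewrite Du mul0r ltxx in DD0.
    - rewrite nmulr_rlt0 // in DD0.
      by rewrite ge_min le_max (ltW Du) (ltW DD0) orbT.
    rewrite pmulr_rlt0 // in DD0.
    by rewrite ge_min le_max (ltW Du) (ltW DD0) orbT.
  by rewrite in_itv /= => uwv /eqP; apply/negP; exact/Hden/(Ii Iu Iv).
move=> Is It; have [st|/ltW ts] := leP s t; first exact: H.
by rewrite mulrC H.
Qed.

(* Cancelling [a - r z] in the equation gives this away from the zeros of
   [a - r z]; transversality extends it to all of [I]. *)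
Lemma derive1_z t : I t -> derive1 z t = x t * D t / rR.
Proof.
have [t0 [It0 zt0]] := Hz; have Dt0 := Hden It0.
(* The constant D t0 makes the expected slope D t0 x D / r positive, whatever the sign of D. *)
pose y u := D t0 * (z u - a / rR).
have Dy u : I u -> is_derive u 1 y (D t0 * derive1 z u).
  move=> Iu; have Dz := is_derive1 (Hzd Iu).
  have -> : y = cst (D t0) * (z - cst (a / rR)) by apply/funext.
  by apply: is_derive_eq; rewrite /GRing.scale /= !fctE; ring.
suff H u : I u -> derive1 y u = D t0 * (x u * D u / rR).
  move=> It; have := H t It; rewrite (derive1_val (Dy _ It)).
  exact: mulfI.
move=> Iu; apply: (@transversal_derive1 _ I y
  (fun u => D t0 * (x u * D u / rR)) oI Ii _ _ _ _ _ u Iu).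
- by move=> s /Dy[].
- move=> s Is; apply: cvgM; first exact: cvg_cst.
  apply: cvgM; last exact: cvg_cst.
  apply: cvgM; last exact: cD.
  by have [+ _] := Dx Is; exact: derivable_continuous.
- move=> s Is; have -> : D t0 * (x s * D s / rR) = x s * (D t0 * D s) / rR by field.
  by rewrite divr_gt0 ?ltr0n // mulr_gt0 ?x_gt0 ?D_same_sign.
- move=> s Is ys; rewrite (derive1_val (Dy _ Is)); congr (_ * _).
  have w0 : a - rR * z s != 0.
    apply: contraNneq ys; rewrite /y => w0; rewrite mulf_eq0 subr_eq0; apply/orP; right.
    by apply/eqP; move/eqP: w0; rewrite subr_eq0 => /eqP ->; field.
  have Ds := Hden Is.
  have e : v_fun n m r k (z s) * derive1 z s = (a - rR * z s) * x s.
    have /eqP := Hode Is; rewrite subr_eq0 => /eqP ->.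
    by rewrite Hx //; ring.
  move: e; rewrite /v_fun => e.
  (* The factor r (a - r z) / D introduced here is v(z), which is nonzero at such a point. *)
  apply: (mulfI (mulf_neq0 r0 w0)); apply: (mulIf (invr_neq0 Ds)).
  rewrite [LHS](_ : _ = rR * (a - rR * z s) / D s * derive1 z s); last by ring.
  by rewrite e; field; rewrite r0 Ds.
exists t0; first by [].
rewrite mulf_neq0 // subr_eq0; apply: contra zt0 => /eqP ->.
by apply/eqP; field.
Qed.

Lemma derive1_f t : I t -> derive1 f t = x t * f t.
Proof. by move=> It; have [f0 _ _] := Hdom It; rewrite -Hff // mulfVK // gt_eqF. Qed.

Lemma derive1_phi t : I t -> derive1 phi t = k * x t * phi t.
Proof. by move=> It; have [_ _ p0] := Hdom It; rewrite -Hphiphi // mulfVK. Qed.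

Lemma derive1_h t : I t -> derive1 h t = x t * z t * h t.
Proof. by move=> It; have [_ h0 _] := Hdom It; rewrite -Hhh // mulfVK // gt_eqF. Qed.

Let Df t : I t -> is_derive t 1 f (x t * f t).
Proof. by move=> It; have := is_derive1 (@Sf 0%N t It); rewrite /= derive1_f. Qed.

Let Dphi t : I t -> is_derive t 1 phi (k * x t * phi t).
Proof. by move=> It; have := is_derive1 (@Sphi 0%N t It); rewrite /= derive1_phi. Qed.

Let Dh t : I t -> is_derive t 1 h (x t * z t * h t).
Proof. by move=> It; have := is_derive1 (@Sh 0%N t It); rewrite /= derive1_h. Qed.

Let Dz t : I t -> is_derive t 1 z (x t * D t / rR).
Proof. by move=> It; have := is_derive1 (Hzd It); rewrite derive1_z. Qed.

(** With these closed forms every quotient f''/f, phi''/phi, h''/h is a polynomial in x and z, and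
    the Ricci equations become algebraic identities. *)
Lemma derive2_f t : I t -> derive1 (derive1 f) t =
  x t ^+ 2 * (a - rR * z t + 1) * f t.
Proof.
move=> It; apply: derive1_val; apply: (@eq_on_derive1 (x * f)) => //.
  by move=> u Iu; rewrite derive1_f.
have [DX DF] := (Dx It, Df It).
by apply: is_derive_eq; rewrite /GRing.scale /=; ring.
Qed.

Lemma derive2_phi t : I t -> derive1 (derive1 phi) t =
  k * x t ^+ 2 * (a - rR * z t + k) * phi t.
Proof.
move=> It; apply: derive1_val; apply: (@eq_on_derive1 (cst k * x * phi)) => //.
  by move=> u Iu; rewrite derive1_phi.
have [DX DF] := (Dx It, Dphi It).
by apply: is_derive_eq; rewrite /GRing.scale /= !fctE; ring.
Qed.

Lemma derive2_h t : I t -> derive1 (derive1 h) t =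
  x t ^+ 2 * ((a - rR * z t) * z t + D t / rR + z t ^+ 2) * h t.
Proof.
move=> It; apply: derive1_val; apply: (@eq_on_derive1 (x * z * h)) => //.
  by move=> u Iu; rewrite derive1_h.
have [[DX DF] DZ] := (Dx It, Dh It, Dz It).
by apply: is_derive_eq; rewrite /GRing.scale /= !fctE; ring.
Qed.

(** The logarithmic derivatives of the four factors, divided by 2 x, are k, z, a - r z and (r - 1) z
    - (k + a), with sum 0. *)
Lemma first_integral s t : I s -> I t ->
  phi s ^+ 2 * h s ^+ 2 * x s ^+ 2 * D s = phi t ^+ 2 * h t ^+ 2 * x t ^+ 2 * D t.
Proof.
pose L u := phi u ^+ 2 * h u ^+ 2 * x u ^+ 2 * D u.
have DL u : I u -> is_derive u 1 L 0.
  move=> Iu; have [[DX DH] [DP D1]] := (Dx Iu, Dh Iu, (Dphi Iu, DD Iu)).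
  have -> : L = phi * phi * (h * h) * (x * x) * (fun u => D u).
    by apply/funext => v; rewrite !fctE /L !expr2.
  apply: is_derive_eq; rewrite /GRing.scale /= !fctE derive1_z //.
  by field.
apply: (itv_derive1_0_eq (y := L) Ii) => u /DL.
  by case.
exact: derive1_val.
Qed.

End WarpingODE.

(** * Products of manifolds *)

Section Countability.

Lemma hausdorff_prod (T U : topologicalType) :
  hausdorff_space T -> hausdorff_space U -> hausdorff_space (T * U)%type.
Proof.
move=> hT hU [p1 p2] [q1 q2] pq; congr (_, _).
- apply: hT => A B pA qB.
  have pA' : nbhs (p1, p2) (A `*` setT)
    by exists (A, setT) => //; split=> //; exact: filterT.
  have qB' : nbhs (q1, q2) (B `*` setT)
    by exists (B, setT) => //; split=> //; exact: filterT.
  by have [[s1 s2] [[/= sA _] [sB _]]] := pq _ _ pA' qB'; exists s1.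
apply: hU => A B pA qB.
have pA' : nbhs (p1, p2) (setT `*` A)
    by exists (setT, A) => //; split=> //; exact: filterT.
have qB' : nbhs (q1, q2) (setT `*` B)
    by exists (setT, B) => //; split=> //; exact: filterT.
by have [[s1 s2] [[/= _ sA] [_ sB]]] := pq _ _ pA' qB'; exists s2.
Qed.

Lemma open_setX (T U : topologicalType) (A : set T) (B : set U) :
  open A -> open B -> open (A `*` B).
Proof.
rewrite !openE => oA oB [p q] [/= Ap Bq]; exists (A, B) => //.
by split; [exact: oA|exact: oB].
Qed.

Lemma second_countable_prod (T U : topologicalType) :
  @second_countable T -> @second_countable U -> @second_countable (T * U)%type.
Proof.
move=> [BT cT [oT bT]] [BU cU [oU bU]].
exists [set A | exists2 CD, (BT `*` BU) CD & A = CD.1 `*` CD.2].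
  rewrite (_ : [set A | _] = (fun CD => CD.1 `*` CD.2) @` (BT `*` BU)).
    by apply: card_le_trans (card_image_le _ _) _; exact: countableX.
  by apply/seteqP; split=> A [CD CDB]; [move=> ->|move=> <-]; exists CD.
split=> [A [[C D] [/oT oC /oU oD] ->]|]; first exact: open_setX.
move=> [p q] N [[C D] [/= pC qD] CDN].
have [C' [BC' C'p] sC] := bT p _ pC; have [D' [BD' D'q] sD] := bU q _ qD.
exists (C' `*` D'); first by split=> //; exists (C', D').
by move=> [s t] [/= /sC Cs /sD Dt]; exact: CDN.
Qed.

Lemma hausdorff_inj (S T : topologicalType) (f : S -> T) :
  continuous f -> injective f -> hausdorff_space T -> hausdorff_space S.
Proof.
move=> cf injf hT p q pq; apply: injf; apply: hT => A B /cf pA /cf qB.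
by have [s [As Bs]] := pq _ _ pA qB; exists (f s).
Qed.

Lemma second_countable_set_type (T : topologicalType) (A : set T) :
  @second_countable T -> @second_countable (set_type A).
Proof.
move=> [B cB [oB bB]].
exists ((fun C => (set_val : A -> T) @^-1` C) @` B).
  exact: card_le_trans (card_image_le _ _) cB.
split=> [_ [C /oB oC <-]|p N]; first by exists C.
rewrite nbhsE => -[_ [[C oC <-] Cp] CN].
have nC : nbhs (set_val p) C by exact: open_nbhs_nbhs.
have [D [BD Dp] DC] := bB _ _ nC.
exists (set_val @^-1` D); first by split=> //; exists D.
by move=> q /DC /CN.
Qed.

(** The boxes with rational corners form a base; they are indexed by finite functions into pairs of
    rationals, a countable type. *)
Lemma second_countable_rV (R : realType) (n : nat) :
  @second_countable 'rV[R]_n.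
Proof.
pose box (p : {ffun 'I_n -> rat * rat}) :=
  [set u : 'rV[R]_n | forall j, ratr (p j).1 < u 0 j < ratr (p j).2].
exists (range box).
  apply: card_le_trans (card_image_le _ _) _; exact: countableP.
split=> [_ [p _ <-]|u N].
  rewrite openE => u bu; exists (fun i j => [set t | ratr (p j).1 < t < ratr (p j).2]).
    move=> i j; rewrite ord1.
    have := @near_in_itvoo R (ratr (p j).1) (ratr (p j).2) (u 0 j).
    by rewrite in_itv /= => /(_ (bu j)); apply: filterS => t; rewrite in_itv.
  by move=> w Hw j; exact: (Hw 0 j).
move=> [P uP PN].
have /choice[p Hp] : forall j, exists p : rat * rat,
    ratr p.1 < u 0 j < ratr p.2 /\ [set t | ratr p.1 < t < ratr p.2] `<=` P 0 j.
  move=> j; have /nbhs_ballP[e /= e0 He] := uP 0 j.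
  have [q1] := @rat_in_itvoo R (u 0 j - e) (u 0 j) (ltac:(by rewrite ltrBlDr ltrDl)).
  have [q2] := @rat_in_itvoo R (u 0 j) (u 0 j + e) (ltac:(by rewrite ltrDl)).
  rewrite !in_itv /= => /andP[a1 a2] /andP[b1 b2].
  exists (q1, q2); rewrite /= b2 a1; split=> // t /= /andP[t1 t2].
  apply: He; rewrite /ball /= distrC ltr_distl.
  by rewrite (lt_trans b1 t1) (lt_trans t2 a2).
exists (box [ffun j => p j]).
  by split; [exists [ffun j => p j]|move=> j; rewrite ffunE; case: (Hp j)].
move=> w Hw; apply: PN => i j; rewrite ord1; apply: (Hp j).2 => /=.
by have := Hw j; rewrite ffunE.
Qed.

End Countability.

Section RowBlocks.
Variables (R : realType) (d e : nat).

Lemma nbhs_row_mx (a : 'rV[R]_d) (b : 'rV[R]_e) (A : set 'rV[R]_(d + e)) :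
  nbhs (row_mx a b) A -> exists2 B, nbhs a B & exists2 C, nbhs b C &
    forall u v, B u -> C v -> A (row_mx u v).
Proof.
move=> [P nP PA].
exists [set u : 'rV[R]_d | forall i j, P i (lshift e j) (u i j)].
  exists (fun i j => P i (lshift e j)) => // i j.
  by have := nP i (lshift e j); rewrite row_mxEl.
exists [set u : 'rV[R]_e | forall i j, P i (rshift d j) (u i j)].
  exists (fun i j => P i (rshift d j)) => // i j.
  by have := nP i (rshift d j); rewrite row_mxEr.
move=> u v Bu Cv; apply: PA => i j; rewrite -(splitK j).
by case: (fintype.split j) => k /=; rewrite ?row_mxEl ?row_mxEr.
Qed.

Lemma row_mx_nbhs (a : 'rV[R]_d) (b : 'rV[R]_e) B C :
  nbhs a B -> nbhs b C ->
  nbhs (row_mx a b) [set u | B (lsubmx u) /\ C (rsubmx u)].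
Proof.
move=> nB nC; apply: filterI.
  by apply: continuous_lsubmx; rewrite row_mxKl.
by apply: continuous_rsubmx; rewrite row_mxKr.
Qed.

End RowBlocks.

Local Notation coord := Defs.coord.

Section Charts.
Variables (R : realType) (d : nat) (M : srm R d).
Hypothesis SM : smooth_manifold M.

Lemma coord_inj (i : chart M) p q :
  dom i p -> dom i q -> coord i p = coord i q -> p = q.
Proof. by have [_ _ cM _] := SM; have [_ _ + _] := cM i; exact. Qed.

Lemma open_coord (i : chart M) (O : set (points M)) :
  open O -> O `<=` dom i -> open (coord i @` O).
Proof. by have [_ _ cM _] := SM; have [_ _ _] := cM i; exact. Qed.

Lemma open_dom (i : chart M) : open (dom i).
Proof. by have [_ _ cM _] := SM; have [] := cM i. Qed.

Lemma open_chart_image (i : chart M) : open (coord i @` dom i).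
Proof. by apply: open_coord => //; exact: open_dom. Qed.

Lemma in_chart_coord (i : chart M) a b (F : points M -> 'M[R]_(a, b)) p :
  dom i p -> in_chart i F (coord i p) = F p.
Proof.
move=> ip; apply: xget_unique; first by exists p.
by move=> _ [q [/= iq /(coord_inj iq ip) ->] <-].
Qed.

End Charts.

(** The local expression is existential and free outside the chart image, so that an explicit
    function of xi can serve as witness. *)
Definition smooth_function (R : realType) (d : nat) (M : srm R d)
    (f : points M -> R) : Prop :=
  forall i : chart M, exists2 w : 'rV[R]_d -> R, smooth_on (coord i @` dom i) w &
    forall p, dom i p -> w (coord i p) = f p.

(** * Index of block and rescaled matrices *)

Section Index.
Variable R : realType.

Lemma has_index_block d e (A : 'M[R]_d) (B : 'M[R]_e) nA nB :
  has_index A nA -> has_index B nB -> has_index (block_mx A 0 0 B) (nA + nB).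
Proof.
move=> [P [s [uP PA s1 cs]]] [Q [t [uQ QB t1 ct]]].
exists (block_mx P 0 0 Q), (row_mx s t); split.
- by rewrite block_diag_mx_unit uP uQ.
- rewrite tr_block_mx !trmx0 !mulmx_block !(mulmx0, mul0mx, addr0, add0r) PA QB.
  by rewrite diag_mx_row.
- move=> j; rewrite -(splitK j); case: (fintype.split j) => k /=.
    by rewrite row_mxEl.
  by rewrite row_mxEr.
rewrite -cs -ct -!sum1_card big_split_ord /=.
by congr (_ + _)%N; apply: eq_bigl => j; rewrite !inE ?row_mxEl ?row_mxEr.
Qed.

(** A pseudo-orthonormal basis for A becomes one for c^2 A when divided by c, with the same
    signs. *)
Lemma has_indexZ d (A : 'M[R]_d) (c : R) nA : c != 0 ->
  has_index A nA -> has_index (c ^+ 2 *: A) nA.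
Proof.
move=> c0 [P [s [uP PA s1 cs]]]; exists (c^-1 *: P), s; split => //.
  by rewrite unitmxZ // unitfE invr_eq0.
have -> : (c^-1 *: P)^T = c^-1 *: P^T by rewrite linearZ.
rewrite -PA -scalemxAr -!scalemxAl -scalemxAr -scalemxAl !scalerA.
by rewrite (_ : _ * _ = 1) ?scale1r //; field.
Qed.

Lemma has_index_diag d (s : 'rV[R]_d) : (forall j, s 0 j = 1 \/ s 0 j = -1) ->
  has_index (diag_mx s) #|[set j | s 0 j == -1]%SET|.
Proof.
move=> s1; exists 1%:M, s; split=> //; first exact: unitmx1.
by rewrite mul1mx trmx1 mulmx1.
Qed.

End Index.

Lemma jacobian_id (R : realType) (d : nat) (U : set 'rV[R]_d)
  (tau : 'rV[R]_d -> 'rV[R]_d) u : open U -> U u ->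
  (forall w, U w -> tau w = w) -> jacobian_mx tau u = 1%:M.
Proof.
move=> oU Uu tauE; apply/matrixP => k l; rewrite !mxE.
rewrite (eq_partial _ oU Uu (g := fun w => w 0 l)); last by move=> w /tauE ->.
by rewrite partial_coord eq_sym.
Qed.

(** * Warped products of semi-Riemannian manifolds *)

Section WarpedProduct.
Variables (R : realType) (d e : nat) (B : srm R d) (F : srm R e).
Variable f : points B -> R.

Let W := warped_product f F.

Section Manifold.
Hypotheses (mB : smooth_manifold B) (mF : smooth_manifold F).

Lemma warped_image (i : chart B) (j : chart F) (P : set (points B))
    (Q : set (points F)) :
  (@Defs.coord _ _ W (i, j)) @` (P `*` Q) =
  [set u | (coord i @` P) (lsubmx u) /\ (coord j @` Q) (rsubmx u)].
Proof.
apply/seteqP; split=> [_ [[p q] [/= Pp Qq] <-]|u [[p Pp pu] [q Qq qu]]].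
  by rewrite /= row_mxKl row_mxKr; split; [exists p|exists q].
by exists (p, q) => //=; rewrite pu qu hsubmxK.
Qed.

Let warped_imageS (i : chart B) (j : chart F) (O : set (points B * points F)) :
  open O -> O `<=` dom i `*` dom j -> open ((@Defs.coord _ _ W (i, j)) @` O).
Proof.
move=> oO sO; rewrite openE => _ [[p q] Opq <-].
have [[P Q] [/= nP nQ] PQO] : nbhs (p, q) O by exact: open_nbhs_nbhs.
move: nP nQ; rewrite !nbhsE => -[P' [oP' P'p] P'P] -[Q' [oQ' Q'q] Q'Q].
have P'O s t : P' s -> Q' t -> O (s, t) by move=> /P'P Ps /Q'Q Qt; exact: PQO.
have P'i : P' `<=` dom i by move=> s P's; have [] := sO _ (P'O s q P's Q'q).
have Q'j : Q' `<=` dom j by move=> t Q't; have [] := sO _ (P'O p t P'p Q't).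
have nP' : nbhs (coord i p) (coord i @` P').
  by apply: open_nbhs_nbhs; split; [exact: (open_coord mB)|exists p].
have nQ' : nbhs (coord j q) (coord j @` Q').
  by apply: open_nbhs_nbhs; split; [exact: (open_coord mF)|exists q].
apply: filterS (row_mx_nbhs nP' nQ') => u [[s P's su] [t Q't tu]].
by exists (s, t); [exact: P'O|rewrite /= su tu hsubmxK].
Qed.

Let warped_coord_inj (i : chart W) p q : dom i p -> dom i q ->
  coord i p = coord i q -> p = q.
Proof.
case: i p q => i j [p1 p2] [q1 q2] [/= ip jp] [/= iq jq] /eq_row_mx[e1 e2].
by rewrite (coord_inj mB ip iq e1) (coord_inj mF jp jq e2).
Qed.

(** [in_chart_coord] presupposes a manifold, and this is a step towards showing that W is one;
    injectivity of the product charts is enough. *)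
Lemma in_chart_warped (i : chart W) a b (H : points W -> 'M[R]_(a, b)) p :
  dom i p -> in_chart i H (coord i p) = H p.
Proof.
move=> ip; apply: xget_unique; first by exists p.
by move=> _ [q [/= iq /(warped_coord_inj iq ip) ->] <-].
Qed.

Lemma transition_warped (i j : chart W) u : (coord i @` (dom i `&` dom j)) u ->
  transition i j u = row_mx (transition i.1 j.1 (lsubmx u))
                            (transition i.2 j.2 (rsubmx u)).
Proof.
move=> [p [ip jp] <-]; rewrite /transition in_chart_warped //=.
case: ip => i1 i2; rewrite row_mxKl row_mxKr (in_chart_coord mB) //.
by rewrite (in_chart_coord mF).
Qed.

Let domI (i j : chart W) : dom i `&` dom j =
  (dom i.1 `&` dom j.1) `*` (dom i.2 `&` dom j.2).
Proof.
by apply/seteqP; split=> p /= => [[[a1 a2] [b1 b2]]|[[a1 a2] [b1 b2]]].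
Qed.

Let open_warped_overlap (i j : chart W) : open (coord i @` (dom i `&` dom j)).
Proof.
case: i j => i1 i2 j; apply: warped_imageS; last by move=> p [].
rewrite domI; apply: open_setX; apply: openI; exact: open_dom.
Qed.

Lemma smooth_manifold_warped : smooth_manifold W.
Proof.
have [[hB cB] covB cMB tB] := mB; have [[hF cF] covF cMF tF] := mF.
split.
- by split; [exact: hausdorff_prod|exact: second_countable_prod].
- move=> [p q]; have [i ip] := covB p; have [j jq] := covF q.
  by exists (i, j).
- move=> i; split.
  + by apply: open_setX; exact: open_dom.
  + move=> [p q] [/= ip jq].
    have [_ cib _ _] := cMB i.1; have [_ cjf _ _] := cMF i.2.
    move=> A /nbhs_row_mx[P nP [Q nQ PQA]].
    have nP' := cib _ ip _ nP; have nQ' := cjf _ jq _ nQ.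
    exists (coord i.1 @^-1` P, coord i.2 @^-1` Q) => //.
    by move=> [s t] [/= Ps Qt]; exact: PQA.
  + exact: warped_coord_inj.
  by case: i => i j O; exact: warped_imageS.
move=> i j l; rewrite -(splitK l).
have oij := @open_warped_overlap i j.
have image_ij u : (coord i @` (dom i `&` dom j)) u ->
    (coord i.1 @` (dom i.1 `&` dom j.1)) (lsubmx u) /\
    (coord i.2 @` (dom i.2 `&` dom j.2)) (rsubmx u).
  move=> [p [[i1 i2] [j1 j2]] <-]; rewrite /= row_mxKl row_mxKr.
  by split; [exists p.1|exists p.2].
case: (fintype.split l) => {}l /=.
  apply: (eq_smooth_on oij (f := fun u => transition i.1 j.1 (lsubmx u) 0 l)).
    by move=> u iju; rewrite transition_warped // row_mxEl.
  by apply: smooth_on_lsubmx (tB i.1 j.1 l) => u /image_ij[].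
apply: (eq_smooth_on oij (f := fun u => transition i.2 j.2 (rsubmx u) 0 l)).
  by move=> u iju; rewrite transition_warped // row_mxEr.
by apply: smooth_on_rsubmx (tF i.2 j.2 l) => u /image_ij[].
Qed.

Lemma jacobian_warped (i j : chart W) p : dom i p -> dom j p ->
  jacobian_mx (transition i j) (coord i p) =
  block_mx (jacobian_mx (transition i.1 j.1) (coord i.1 p.1)) 0 0
           (jacobian_mx (transition i.2 j.2) (coord i.2 p.2)).
Proof.
move=> ip jp; have oij := @open_warped_overlap i j.
have iju : (coord i @` (dom i `&` dom j)) (coord i p) by exists p.
apply/matrixP => k l; rewrite -(splitK k) -(splitK l) [LHS]mxE.
case: (fintype.split l) => {}l /=.
  rewrite (eq_partial _ oij iju (g := fun u => transition i.1 j.1 (lsubmx u) 0 l)).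
    case: (fintype.split k) => {}k /=.
      rewrite (partial_lsubmx (fun v => transition i.1 j.1 v 0 l)).
      by rewrite block_mxEul mxE /= row_mxKl.
    rewrite (partial_lsubmx0 (fun v => transition i.1 j.1 v 0 l)).
    by rewrite block_mxEdl mxE.
  by move=> u iju'; rewrite transition_warped // row_mxEl.
rewrite (eq_partial _ oij iju (g := fun u => transition i.2 j.2 (rsubmx u) 0 l)).
  case: (fintype.split k) => {}k /=.
    rewrite (partial_rsubmx0 (fun v => transition i.2 j.2 v 0 l)).
    by rewrite block_mxEur mxE.
  rewrite (partial_rsubmx (fun v => transition i.2 j.2 v 0 l)).
  by rewrite block_mxEdr mxE /= row_mxKr.
by move=> u iju'; rewrite transition_warped // row_mxEr.
Qed.

(** Brings the metric of W, read in a chart, to the block form on which the coordinate computation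
    of the Ricci tensor is based. *)
Lemma metric_in_chart_warped (i : chart W) (w : 'rV[R]_d -> R) :
  (forall p, dom i.1 p -> w (coord i.1 p) = f p) ->
  forall u, (coord i.1 @` dom i.1) (lsubmx u) /\ (coord i.2 @` dom i.2) (rsubmx u) ->
  in_chart i (metric i) u =
  block_mx (in_chart i.1 (metric i.1) (lsubmx u)) 0 0
   (w (lsubmx u) ^+ 2 *: in_chart i.2 (metric i.2) (rsubmx u)).
Proof.
move=> wf u [[p ip pu] [q iq qu]].
have uE : u = @Defs.coord _ _ W i (p, q) by rewrite /= pu qu hsubmxK.
rewrite [in LHS]uE in_chart_warped //= -pu -qu wf //.
by rewrite (in_chart_coord mB) // (in_chart_coord mF).
Qed.

End Manifold.

Hypotheses (sB : semi_riemannian B) (sF : semi_riemannian F).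
Hypotheses (f0 : forall p, f p != 0) (Sf : smooth_function f).

Lemma semi_riemannian_warped : semi_riemannian W.
Proof.
have [mB gB tB nB [nuB iB]] := sB; have [mF gF tF nF [nuF iF]] := sF.
split.
- exact: smooth_manifold_warped.
- move=> [i j] k l; have [w Sw wf] := Sf i.
  rewrite (warped_image i j).
  have GE := @metric_in_chart_warped mB mF (i, j) w wf.
  exact: (smooth_on_warped (@open_chart_image _ _ _ mB i) (@open_chart_image _ _ _ mF j)
    (gB i) (gF j) Sw GE k l).
- move=> i j p ip jp /=; rewrite jacobian_warped // tr_block_mx !trmx0 !mulmx_block.
  rewrite !(mulmx0, mul0mx, addr0, add0r) -scalemxAr -scalemxAl.
  by case: ip jp => i1 i2 [j1 j2]; rewrite (tB i.1 j.1) // (tF i.2 j.2).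
- move=> i p [i1 i2] /=; have [tb ub] := nB _ _ i1; have [tf uf] := nF _ _ i2.
  rewrite tr_block_mx !trmx0 linearZ /= tb tf; split=> //.
  by rewrite block_diag_mx_unit ub unitmxZ // unitfE expf_neq0.
exists (nuB + nuF)%N => i p [i1 i2] /=.
by apply: has_index_block; [exact: iB|apply: has_indexZ => //; exact: iF].
Qed.

End WarpedProduct.

(** * The conformally flat base as a manifold *)

Section ConformallyFlatManifold.
Variables (R : realType) (n : nat) (eps : 'rV[R]_n) (U : set 'rV[R]_n).
Variable w : 'rV[R]_n -> R.
Hypothesis Heps : forall i, eps 0 i = 1 \/ eps 0 i = -1.
Hypotheses (oU : open U) (Sw : smooth_on U w) (w0 : forall u, U u -> w u != 0).

Let M := conformal (M := pseudo_euclidean eps U) (fun p => w (set_val p)).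

Lemma set_val_in (p : set_type U) : U (set_val p).
Proof. by rewrite set_valE; exact: set_valP. Qed.

Lemma image_set_val (O : set 'rV[R]_n) :
  (set_val : set_type U -> 'rV[R]_n) @` (set_val @^-1` O) = O `&` U.
Proof.
apply/seteqP; split=> [_ [p Op <-]|u [Ou Uu]]; first by split=> //; exact: set_val_in.
by exists (exist _ u (mem_set Uu)); rewrite /= set_valE.
Qed.

Lemma conformally_flat_image (i : chart M) : coord i @` dom i = U.
Proof. by rewrite -[RHS]setTI -image_set_val preimage_setT. Qed.

Lemma smooth_manifold_conformally_flat : smooth_manifold M.
Proof.
have inj_val : injective (set_val : set_type U -> 'rV[R]_n).
  by move=> p q; rewrite set_valE => /val_inj.
have in_chartE (i : chart M) u : U u -> in_chart i (coord i) u = u.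
  rewrite -(conformally_flat_image i) => -[p _ <-].
  by apply: xget_unique; [exists p|move=> _ [q [_ /inj_val ->] <-]].
split.
- split.
    apply: (hausdorff_inj _ inj_val); first exact: initial_continuous.
    exact: norm_hausdorff.
  by apply: second_countable_set_type; exact: second_countable_rV.
- by move=> p; exists tt.
- move=> i; split.
  + exact: openT.
  + by move=> p _; apply: initial_continuous.
  + by move=> p q _ _ /inj_val.
  move=> _ [Q oQ <-] _; rewrite image_set_val; exact: openI.
move=> i j l; rewrite (_ : dom i `&` dom j = dom i); last exact: setTI.
rewrite conformally_flat_image.
apply: (eq_smooth_on oU (f := fun u => u 0 l)); last exact: smooth_on_coord.
by move=> u Uu; rewrite (_ : transition i j u = u) //; exact: in_chartE.
Qed.

Lemma metric_in_chart_conformally_flat (i : chart M) u : U u ->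
  in_chart i (metric i) u = (w u ^+ 2)^-1 *: diag_mx eps.
Proof.
rewrite -(conformally_flat_image i) => -[p ip <-].
by rewrite (in_chart_coord smooth_manifold_conformally_flat).
Qed.

Let eps_unit : diag_mx eps \in unitmx.
Proof.
suff /mulmx1_unit[] : diag_mx eps *m diag_mx eps = 1%:M by [].
apply/matrixP => i j; rewrite mul_diag_mx !mxE.
case: eqVneq => [->|_]; rewrite ?mulr0 // mulr1n.
by case: (Heps j) => ->; rewrite ?mulr1 // mulrNN mulr1.
Qed.

Lemma semi_riemannian_conformally_flat : semi_riemannian M.
Proof.
have SM := smooth_manifold_conformally_flat.
split=> //.
- move=> i k l; rewrite conformally_flat_image.
  apply: (eq_smooth_on oU (f := fun u => (w u ^+ 2)^-1 * diag_mx eps k l)).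
    by move=> u Uu; rewrite metric_in_chart_conformally_flat // [RHS]mxE.
  apply: smooth_onM => //; last exact: smooth_on_cst.
  apply: smooth_onV => //; last exact: smooth_onX.
  by move=> u Uu; rewrite expf_neq0 ?w0.
- move=> i j p ip jp J; rewrite (_ : J = 1%:M) ?mul1mx ?trmx1 ?mulmx1 //.
  apply: (jacobian_id oU); first exact: set_val_in.
  move=> u; rewrite -(conformally_flat_image i) => -[q iq <-].
  by rewrite /transition (in_chart_coord SM).
- move=> i p _; have wp := w0 (set_val_in p).
  split; first by rewrite /= linearZ /= tr_diag_mx.
  by rewrite /= unitmxZ ?unitfE ?invr_eq0 ?expf_neq0.
exists #|[set j | eps 0 j == -1]%SET| => i p _ /=.
rewrite -exprVn; apply: has_indexZ; first by rewrite invr_eq0 w0 //; exact: set_val_in.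
exact: has_index_diag.
Qed.

End ConformallyFlatManifold.

(** * The sequential warped product *)

(** Reduces the vanishing of a Ricci entry to exhibiting it as a combination of the differential
    equations, which is then a purely algebraic check. *)
Lemma lincomb_eq0 (R : realType) (a b x y z : R) :
  x = 0 -> y = 0 -> z = a * x + b * y -> z = 0.
Proof. by move=> -> -> ->; rewrite !mulr0 addr0. Qed.

Section SequentialWarping.
Variables (R : realType) (n m r : nat) (eps alpha : 'rV[R]_n) (I : set R).
Variables (phi f h : R -> R) (lambda : R).
Variables (V1 : set 'rV[R]_m) (V2 : set 'rV[R]_r).
Variables (G0 : 'rV[R]_n -> 'M[R]_n) (g1 : 'rV[R]_m -> 'M[R]_m).
Variables (g2 : 'rV[R]_r -> 'M[R]_r).
Variables (G1 : 'rV[R]_(n + m) -> 'M[R]_(n + m)).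
Variables (G2 : 'rV[R]_(n + m + r) -> 'M[R]_(n + m + r)).
Hypotheses (oI : open I) (oV1 : open V1) (oV2 : open V2).
Hypothesis Heps : forall i, eps 0 i = 1 \/ eps 0 i = -1.
Hypotheses (Sphi : smooth1_on I phi) (Sf : smooth1_on I f) (Sh : smooth1_on I h).
Hypotheses (phi0 : forall t, I t -> phi t != 0) (f0 : forall t, I t -> f t != 0)
  (h0 : forall t, I t -> h t != 0).
Hypothesis Sg1 : forall i j, smooth_on V1 (fun u => g1 u i j).
Hypothesis Sg2 : forall i j, smooth_on V2 (fun u => g2 u i j).
Hypotheses (ug1 : forall u, V1 u -> g1 u \in unitmx)
  (ug2 : forall u, V2 u -> g2 u \in unitmx).
Hypotheses (sg1 : forall u, V1 u -> (g1 u)^T = g1 u)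
  (sg2 : forall u, V2 u -> (g2 u)^T = g2 u).

Local Notation xi := (linear_form alpha).
Local Notation E := (\sum_i eps 0 i * alpha 0 i ^+ 2).

Let U0 : set 'rV[R]_n := [set u | I (xi u)].
Let U1 : set 'rV[R]_(n + m) := [set u | U0 (lsubmx u) /\ V1 (rsubmx u)].
Let U2 : set 'rV[R]_(n + m + r) := [set u | U1 (lsubmx u) /\ V2 (rsubmx u)].

Hypothesis G0E : forall u, U0 u -> G0 u = (phi (xi u) ^+ 2)^-1 *: diag_mx eps.
Hypothesis G1E : forall u, U1 u -> G1 u =
  block_mx (G0 (lsubmx u)) 0 0 (f (xi (lsubmx u)) ^+ 2 *: g1 (rsubmx u)).
Hypothesis G2E : forall u, U2 u -> G2 u =
  block_mx (G1 (lsubmx u)) 0 0 (h (xi (lsubmx (lsubmx u))) ^+ 2 *: g2 (rsubmx u)).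

Hypothesis ricci_g1 : forall u, V1 u -> ricci_coord g1 u = 0.
Hypothesis ricci_g2 : forall u, V2 u -> ricci_coord g2 u = lambda *: g2 u.

(* The first two equations are the coefficients of [alpha_i alpha_j] and of
   [g_ij] in the base block of the Ricci tensor. *)
Hypothesis eq_xi : forall t, I t ->
  (n%:R - 2) * (derive1 (derive1 phi) t / phi t)
  - m%:R / f t * (derive1 (derive1 f) t + 2 * (derive1 phi t / phi t) * derive1 f t)
  - r%:R / h t * (derive1 (derive1 h) t + 2 * (derive1 phi t / phi t) * derive1 h t)
  = 0.
Hypothesis eq_g : forall t, I t ->
  derive1 (derive1 phi) t / phi t - (n%:R - 1) * (derive1 phi t / phi t) ^+ 2
  + m%:R / f t * (derive1 phi t / phi t * derive1 f t)
  + r%:R / h t * (derive1 phi t / phi t * derive1 h t) = 0.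
Hypothesis eq_F1 : forall t, I t ->
  f t * (derive1 (derive1 f) t - (n%:R - 2) * (derive1 phi t / phi t) * derive1 f t)
  + (m%:R - 1) * derive1 f t ^+ 2 + r%:R / h t * (f t * (derive1 f t * derive1 h t))
  = 0.
Hypothesis eq_F2 : forall t, I t ->
  E * phi t ^+ 2 *
  (h t * (derive1 (derive1 h) t - (n%:R - 2) * (derive1 phi t / phi t) * derive1 h t
     + m%:R / f t * (derive1 h t * derive1 f t))
   + (r%:R - 1) * derive1 h t ^+ 2) = lambda.

Let oU0 : open U0. Proof. exact: open_linear_form. Qed.
Let SG0 := smooth_on_conformally_flat oI Sphi phi0 G0E.
Let uG0 := unitmx_conformally_flat Heps phi0 G0E.

Let Sfx : smooth_on U0 (fun u => f (xi u)). Proof. exact: smooth_on_linear_form. Qed.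
Let Shx : smooth_on U0 (fun u => h (xi u)). Proof. exact: smooth_on_linear_form. Qed.
Let fx0 u : U0 u -> f (xi u) != 0. Proof. exact: f0. Qed.
Let hx0 u : U0 u -> h (xi u) != 0. Proof. exact: h0. Qed.

Let oU1 : open U1. Proof. exact: open_lrsubmx. Qed.
Let SG1 := smooth_on_warped oU0 oV1 SG0 Sg1 Sfx G1E.
Let uG1 := unitmx_warped uG0 ug1 fx0 G1E.

Let Shx1 : smooth_on U1 (fun u => h (xi (lsubmx u))).
Proof. by apply: smooth_on_lsubmx Shx => u []. Qed.
Let hx01 u : U1 u -> h (xi (lsubmx u)) != 0. Proof. by case=> /hx0. Qed.

(** The warped formulas are applied to (base x F1) x F2, and the base block of the result is split
    once more over base x F1. The matrix functions are prescribed on open sets only, so that metrics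
    read through [in_chart], with their default value 0 elsewhere, are admissible. *)
Lemma ricci_sequential_warping u : U2 u -> ricci_coord G2 u = 0.
Proof.
move=> U2u; have [U1u V2u] := U2u; have [U0u V1u] := U1u.
set u1 := lsubmx u; set u0 := lsubmx u1; set t := xi u0.
have It : I t := U0u.
have [ft ht pt] : [/\ f t != 0, h t != 0 & phi t != 0].
  by split; [exact: f0|exact: h0|exact: phi0].
apply/matrixP => K L; rewrite -(splitK K) -(splitK L) [RHS]mxE.
case: (fintype.split K) => {}K; case: (fintype.split L) => {}L.
- rewrite /= (ricci_warped_ll oU1 oV2 Sg2 uG1 ug2 sg2 Shx1 hx01 G2E) //.
  rewrite -(splitK K) -(splitK L) -/u1 -/u0 -/t.
  case: (fintype.split K) => {}K; case: (fintype.split L) => {}L /=.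
  + rewrite (ricci_warped_ll oU0 oV1 Sg1 uG0 ug1 sg1 Sfx fx0 G1E) //.
    rewrite (hessian_warped_ll oU0 oV1 uG0 ug1 fx0 G1E (fun u => h (xi u))) // -/u0.
    rewrite (ricci_conformally_flat oI Heps Sphi phi0 G0E) //.
    rewrite (hessian_radial oI Heps Sphi phi0 G0E Sf) //.
    rewrite (hessian_radial oI Heps Sphi phi0 G0E Sh) // -/t.
    move: (eps 0 K * _) (E) (alpha 0 K * alpha 0 L) => dKL EE aKL.
    apply: (lincomb_eq0 (a := aKL) (b := EE * dKL) (eq_xi It) (eq_g It)).
    (* Abstracting the quotients leaves a polynomial identity, without denominators. *)
    move: (m%:R / f t) (r%:R / h t) (derive1 (derive1 phi) t / phi t)
      (derive1 phi t / phi t) => mf rh P q.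
    move: (derive1 (derive1 f) t) (derive1 f t) (derive1 (derive1 h) t)
      (derive1 h t) (n%:R : R) => f2 f1 h2 h1 nR.
    clear -mf rh P q f2 f1 h2 h1 nR dKL EE aKL.
    by ring.
  + rewrite (ricci_warped_lr oU0 oV1 Sg1 uG0 ug1 sg1 Sfx fx0 G1E) //.
    by rewrite (hessian_warped_lr oU0 oV1 uG0 ug1 fx0 G1E
      (fun u => h (xi u))) // mulr0 subr0.
  + rewrite (ricci_warped_rl oU0 oV1 Sg1 uG0 ug1 sg1 Sfx fx0 G1E) //.
    by rewrite (hessian_warped_rl oU0 oV1 uG0 ug1 fx0 G1E
      (fun u => h (xi u))) // mulr0 subr0.
  rewrite (ricci_warped_rr oU0 oV1 SG0 Sg1 uG0 ug1 sg1 Sfx fx0 G1E) //.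
  rewrite (hessian_warped_rr oU0 oV1 Sg1 uG0 ug1 Sfx fx0 G1E
    (fun u => h (xi u))) // -/u0.
  rewrite ricci_g1 // mxE.
  rewrite (laplacian_radial oI Heps Sphi phi0 G0E Sf) //.
  rewrite (gradient_dot_radial Heps phi0 G0E Sf Sf) //.
  rewrite (gradient_dot_radial Heps phi0 G0E Sf Sh) // -/t.
  (* The F1 block is a multiple of the single equation [eq_F1]; the second summand is a placeholder
     with coefficient 0. *)
  apply: (lincomb_eq0 (a := - E * phi t ^+ 2 * g1 (rsubmx u1) K L) (b := 0)
    (eq_F1 It) (eq_F1 It)).
  by field; rewrite ?ft ?ht ?pt.
- by rewrite /= (ricci_warped_lr oU1 oV2 Sg2 uG1 ug2 sg2 Shx1 hx01 G2E).
- by rewrite /= (ricci_warped_rl oU1 oV2 Sg2 uG1 ug2 sg2 Shx1 hx01 G2E).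
rewrite /= (ricci_warped_rr oU1 oV2 SG1 Sg2 uG1 ug2 sg2 Shx1 hx01 G2E) //.
rewrite ricci_g2 // mxE -/u1.
rewrite (laplacian_warped oU0 oV1 Sg1 uG0 ug1 sg1 Sfx fx0 G1E
  (fun u => h (xi u))) //.
rewrite (gradient_dot_warped uG0 ug1 fx0 G1E (fun u => h (xi u))
  (fun u => h (xi u))) // -/u0.
rewrite (laplacian_radial oI Heps Sphi phi0 G0E Sh) //.
rewrite (gradient_dot_radial Heps phi0 G0E Sh Sh) //.
rewrite (gradient_dot_radial Heps phi0 G0E Sh Sf) // -/t.
rewrite -(eq_F2 It); by field; rewrite ?ft ?ht ?pt.
Qed.

End SequentialWarping.

(* I is the interval of values of xi on which the functions live, V is the
   antiderivative of v.  The hypothesis Hz excludes the stationary solution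
   z = a / r of the first equation, at which v vanishes identically: for it the
   metric is in general not Ricci-flat.  The Einstein constant of F2 is
   determined by f, h, phi (including their integration constants), whence its
   quantification before F1 and F2. *)
Theorem corollary2p3 (R : realType) (n m r : nat)
  (hn : (3 <= n)%N) (hm : (0 < m)%N) (hr : (0 < r)%N)
  (eps alpha : 'rV[R]_n) (i0 : 'I_n)
  (Heps : forall i, eps 0 i = 1 \/ eps 0 i = -1)
  (Halpha : \sum_(i < n) eps 0 i * alpha 0 i ^+ 2 = eps 0 i0)
  (k c : R) (hk : 0 < k) (hc : 0 < c)
  (I : set R) (HIo : open I) (HIi : is_interval I)
  (f h phi x z V : R -> R)
  (Hf : smooth1_on I f) (Hh : smooth1_on I h) (Hphi : smooth1_on I phi)
  (Hdom : forall t, I t -> [/\ 0 < f t, 0 < h t & phi t != 0])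
  (Hden : forall t, I t -> v_den n m r k (z t) != 0)
  (HV : forall t, I t -> is_derive (z t) 1 V (v_fun n m r k (z t)))
  (Hzd : forall t, I t -> derivable z t 1)
  (Hode : forall t, I t ->
    v_fun n m r k (z t) * derive1 z t
    - c * (coef_a n m k - r%:R * z t) * expR (V (z t)) = 0)
  (Hz : exists t, I t /\ r%:R * z t != coef_a n m k)
  (Hx : forall t, I t -> x t = c * expR (V (z t)))
  (Hff : forall t, I t -> derive1 f t / f t = x t)
  (Hphiphi : forall t, I t -> derive1 phi t / phi t = k * x t)
  (Hhh : forall t, I t -> derive1 h t / h t = x t * z t) :
  exists lambda2 : R, forall (F1 : srm R m) (F2 : srm R r),
    semi_riemannian F1 -> ricci_flat F1 ->
    semi_riemannian F2 -> einstein F2 lambda2 ->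
    let W := seq_warped eps alpha I phi f h F1 F2 in
    semi_riemannian W /\ ricci_flat W.
Proof.
have [t0 [It0 zt0]] := Hz.
have f0 t : I t -> f t != 0 by move=> /Hdom[ft _ _]; rewrite gt_eqF.
have h0 t : I t -> h t != 0 by move=> /Hdom[_ ht _]; rewrite gt_eqF.
have phi0 t : I t -> phi t != 0 by move=> /Hdom[].
have r0 : r%:R != 0 :> R by rewrite pnatr_eq0 -lt0n.
have E1 t (It : I t) := derive1_f Hdom Hff It.
have E2 t (It : I t) := derive1_phi Hdom Hphiphi It.
have E3 t (It : I t) := derive1_h Hdom Hhh It.
have F1' t (It : I t) := derive2_f HIo Hf Hdom HV Hzd Hode Hx Hff It.
have F2' t (It : I t) := derive2_phi HIo Hphi Hdom HV Hzd Hode Hx Hphiphi It.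
have F3' t (It : I t) := derive2_h hr hc HIo HIi Hh Hdom Hden HV Hzd Hode Hz Hx Hhh It.
pose L t := phi t ^+ 2 * h t ^+ 2 * x t ^+ 2 * v_den n m r k (z t).
have LE t (It : I t) : L t = L t0 :=
  first_integral hr hc HIo HIi Hh Hphi Hdom Hden HV Hzd Hode Hz Hx Hphiphi Hhh It It0.
(* The left side of [eq_F2] simplifies to eps_i0 L t / r; since L is a first integral, its value at
   any one point t0 serves. *)
exists (eps 0 i0 * L t0 / r%:R) => F1 F2 sF1 rF1 sF2 eF2 W.
pose U : set 'rV[R]_n := [set u | I (linear_form alpha u)].
have oU : open U by exact: open_linear_form.
have Swphi := smooth_on_linear_form alpha HIo Hphi.
have Swf := smooth_on_linear_form alpha HIo Hf.
have Swh := smooth_on_linear_form alpha HIo Hh.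
have wphi0 u : U u -> phi (linear_form alpha u) != 0 by exact: phi0.
have sB0 := semi_riemannian_conformally_flat Heps oU Swphi wphi0.
set B0 := conformal _ in sB0.
have imB0 (i : chart B0) : Defs.coord i @` dom i = U.
  exact: (@conformally_flat_image _ _ eps U (fun u => phi (linear_form alpha u))).
pose fB (p : points B0) := f (linear_form alpha (set_val p)).
have fB0 p : fB p != 0 by exact: (f0 _ (set_val_in p)).
have SfB : smooth_function fB.
  move=> i; exists (fun u => f (linear_form alpha u)) => //.
  by rewrite imB0.
have sB1 := semi_riemannian_warped sB0 sF1 fB0 SfB.
set B1 := warped_product _ _ in sB1.
pose hB (p : points B1) := h (linear_form alpha (set_val p.1)).
have hB0 p : hB p != 0 by exact: (h0 _ (set_val_in p.1)).
have hB_chart (i : chart B1) p : dom i p ->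
    h (linear_form alpha (lsubmx (Defs.coord i p))) = hB p.
  by move=> _; rewrite /= row_mxKl.
have ShB : smooth_function hB.
  move=> [i j]; exists (fun u => h (linear_form alpha (lsubmx u))) => //.
    rewrite warped_image; apply: smooth_on_lsubmx Swh => u [+ _].
    by rewrite imB0.
  exact: (hB_chart (i, j)).
have sW : semi_riemannian W := semi_riemannian_warped sB1 sF2 hB0 ShB.
split=> // -[[i1 i2] j] p [[ip1 ip2] jp]; rewrite scale0r /ricci.
have [mB0 _ _ _ _] := sB0; have [mB1 _ _ _ _] := sB1.
have [mF1 g1 _ n1 _] := sF1; have [mF2 g2 _ n2 _] := sF2.
pose c0 : chart B0 := i1; pose c1 : chart B1 := (i1, i2).
pose c2 : chart W := ((i1, i2), j).
have fB_chart q : dom c0 q -> f (linear_form alpha (Defs.coord c0 q)) = fB q by [].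
have in_F1 u : (Defs.coord i2 @` dom i2) u ->
    [/\ in_chart i2 (metric i2) u \in unitmx,
        (in_chart i2 (metric i2) u)^T = in_chart i2 (metric i2) u
      & ricci_coord (in_chart i2 (metric i2)) u = 0].
  move=> [q iq <-]; rewrite (in_chart_coord mF1) //; have [] := n1 _ _ iq.
  by split=> //; rewrite -[RHS](scale0r (metric i2 q)) -rF1.
have in_F2 u : (Defs.coord j @` dom j) u ->
    [/\ in_chart j (metric j) u \in unitmx,
        (in_chart j (metric j) u)^T = in_chart j (metric j) u
      & ricci_coord (in_chart j (metric j)) u =
          (eps 0 i0 * L t0 / r%:R) *: in_chart j (metric j) u].
  move=> [q iq <-]; rewrite (in_chart_coord mF2) //; have [] := n2 _ _ iq.
  by split=> //; rewrite -eF2.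
apply: (@ricci_sequential_warping R n m r eps alpha I phi f h
  (eps 0 i0 * L t0 / r%:R) (Defs.coord i2 @` dom i2) (Defs.coord j @` dom j)
  (in_chart c0 (metric c0)) (in_chart i2 (metric i2)) (in_chart j (metric j))
  (in_chart c1 (metric c1)) (in_chart c2 (metric c2))) => //.
- exact: (@open_chart_image _ _ _ mF1).
- exact: (@open_chart_image _ _ _ mF2).
- by move=> u /in_F1[].
- by move=> u /in_F2[].
- by move=> u /in_F1[].
- by move=> u /in_F2[].
- move=> u Uu.
  exact: (@metric_in_chart_conformally_flat _ _ _ U
    (fun u => phi (linear_form alpha u)) oU c0 u Uu).
- move=> u u1.
  have {}u1 : (Defs.coord c0 @` dom c0) (lsubmx u) /\
      (Defs.coord i2 @` dom i2) (rsubmx u) by rewrite imB0.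
  exact: (@metric_in_chart_warped _ _ _ B0 F1 fB mB0 mF1 c1
    (fun u => f (linear_form alpha u)) fB_chart u u1).
- move=> u u2.
  have {}u2 : (Defs.coord c1 @` dom c1) (lsubmx u) /\
      (Defs.coord j @` dom j) (rsubmx u) by rewrite warped_image imB0.
  exact: (@metric_in_chart_warped _ _ _ B1 F2 hB mB1 mF2 c2
    (fun u => h (linear_form alpha (lsubmx u))) (hB_chart c1) u u2).
- by move=> u /in_F1[].
- by move=> u /in_F2[].
(* This is [eq_xi], where b matters: the term D / r of h''/h has to cancel everything else, so
   [v_den] is unfolded. *)
- move=> t It; have [ft [ht pt]] := (f0 t It, (h0 t It, phi0 t It)).
  rewrite F1' // F2' // F3' // E1 // E2 // E3 // /v_den /coef_b /coef_a.
  by field; rewrite ?ft ?ht ?pt ?r0.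
(* This goal and the next are x' - x^2 (a - r z) = 0 multiplied by k and by f^2 respectively. *)
- move=> t It; have [ft [ht pt]] := (f0 t It, (h0 t It, phi0 t It)).
  rewrite F2' // E1 // E2 // E3 // /coef_a.
  by field; rewrite ?ft ?ht ?pt ?r0.
- move=> t It; have [ft [ht pt]] := (f0 t It, (h0 t It, phi0 t It)).
  rewrite F1' // E1 // E2 // E3 // /coef_a.
  by field; rewrite ?ft ?ht ?pt ?r0.
(* The constant is evaluated at the current t by the first integral. Here D stays folded: on the
   left all terms but h^2 x^2 D / r cancel. *)
- move=> t It; have [ft [ht pt]] := (f0 t It, (h0 t It, phi0 t It)).
  rewrite Halpha -(LE t It) /L F3' // E1 // E2 // E3 // /coef_a.
  by field; rewrite ?ft ?ht ?pt ?r0.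
rewrite /= !row_mxKl !row_mxKr; split; last by exists p.2.
split; last by exists p.1.2.
exact: (set_val_in p.1.1).
Qed.
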